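(* Let $G\subset PSL(3,\mathbb{C})$ be an infinite discrete group with an exceptional algebraic set. Then either $G$ is virtually affine, or $G$ is, up to conjugation in $PSL(3,\mathbb{C})$, the image $\iota(\Gamma)$ of a Kleinian group $\Gamma\subset PSL(2,\mathbb{C})$ of Möbius transformations under the irreducible representation $\iota:PSL(2,\mathbb{C})\to PSL(3,\mathbb{C})$.
   Context: $PSL(3,\mathbb{C})$ acts on the complex projective plane $\mathbb{P}^2_{\mathbb{C}}$ by projective transformations. An exceptional algebraic set for an infinite group $G\subset PSL(3,\mathbb{C})$ is a complex algebraic curve $S\subset\mathbb{P}^2_{\mathbb{C}}$ that is $G$-invariant. A subgroup of $PSL(3,\mathbb{C})$ is affine if it leaves a complex line in $\mathbb{P}^2_{\mathbb{C}}$ invariant (equivalently, it is conjugate to a group of affine transformations of $\mathbb{C}^2$), and virtually affine if it has an affine subgroup of finite index. Kleinian group here means a discrete subgroup of $PSL(2,\mathbb{C})\cong \mathrm{Mob}(\hat{\mathbb{C}})$. The irreducible representation $\iota$ is given by $$\iota\left(\frac{az+b}{cz+d}\right)=\begin{bmatrix} a^2&ab&b^2\\ 2ac&ad+bc&2bd\\ c^2&dc&d^2\end{bmatrix},\qquad ad-bc=1.$$ *)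

(* Defs.v *)
From HB Require Import structures.
From mathcomp Require Import all_boot all_order all_algebra.
From mathcomp Require Import mpoly ring.
From mathcomp Require Import boolp classical_sets functions cardinality.
From mathcomp Require Import topology normedtype.

Set Implicit Arguments.
Unset Strict Implicit.
Unset Printing Implicit Defensive.

Import GRing.Theory Num.Theory.
Import numFieldNormedType.Exports.

Local Open Scope classical_set_scope.
Local Open Scope ring_scope.
Local Open Scope quotient_scope.

Section Proportional.
Context {K : fieldType} {m n : nat}.
Implicit Types A B C : 'M[K]_(m, n).

Definition proportional A B : bool := `[< exists2 c : K, c != 0 & A = c *: B >].

Lemma proportionalP A B :
  reflect (exists2 c : K, c != 0 & A = c *: B) (proportional A B).
Proof. exact: asboolP. Qed.

Lemma proportional_refl A : proportional A A.
Proof. by apply/proportionalP; exists 1; rewrite ?oner_neq0 ?scale1r. Qed.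

Lemma proportional_impl A B : proportional A B -> proportional B A.
Proof.
move=> /proportionalP[c c0 ->]; apply/proportionalP; exists c^-1.
  by rewrite invr_eq0.
by rewrite scalerA mulVf ?scale1r.
Qed.

Lemma proportional_sym A B : proportional A B = proportional B A.
Proof. by apply/idP/idP; apply: proportional_impl. Qed.

Lemma proportional_trans B A C :
  proportional A B -> proportional B C -> proportional A C.
Proof.
move=> /proportionalP[c c0 ->] /proportionalP[d d0 ->].
by apply/proportionalP; exists (c * d); rewrite ?mulf_neq0 ?scalerA.
Qed.

End Proportional.

Lemma proportional_mul (K : fieldType) m n p (A B : 'M[K]_(m, n))
    (C D : 'M[K]_(n, p)) :
  proportional A B -> proportional C D -> proportional (A *m C) (B *m D).
Proof.
move=> /proportionalP[c c0 ->] /proportionalP[d d0 ->].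
apply/proportionalP; exists (c * d); rewrite ?mulf_neq0 //.
by rewrite -scalemxAl -scalemxAr scalerA.
Qed.

Lemma proportional_inv (K : fieldType) n (A B : 'M[K]_n) :
  A \in unitmx -> proportional A B -> proportional (invmx A) (invmx B).
Proof.
move=> uA /proportionalP[c c0 eA]; apply/proportionalP; exists c^-1.
  by rewrite invr_eq0.
have uB : B \in unitmx.
  by move: uA; rewrite eA unitmxZ // unitfE.
apply: (can_inj (mulKmx uA)); rewrite mulmxV // {1}eA.
by rewrite -scalemxAl -scalemxAr scalerA mulfV // scale1r mulmxV.
Qed.

Record SL (K : numClosedFieldType) (n : nat) :=
  MkSL { SLmx :> 'M[K]_n; SLmx_det : \det SLmx == 1 }.

Section SpecialLinear.
Context {K : numClosedFieldType} {n : nat}.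
Implicit Types A B C : SL K n.

HB.instance Definition _ := [isSub for @SLmx K n].
HB.instance Definition _ := [Choice of SL K n by <:].

Lemma SL_detE A : \det A = 1.
Proof. exact/eqP/SLmx_det. Qed.

Lemma SL_unitmx A : SLmx A \in unitmx.
Proof. by rewrite unitmxE SL_detE unitr1. Qed.

Fact SL_one_det : \det (1%:M : 'M[K]_n) == 1.
Proof. by rewrite det1. Qed.
Fact SL_mul_det A B : \det (A *m B) == 1.
Proof. by rewrite det_mulmx !SL_detE mulr1. Qed.
Fact SL_inv_det A : \det (invmx A) == 1.
Proof. by rewrite det_inv SL_detE invr1. Qed.

Definition SL_one : SL K n := MkSL SL_one_det.
Definition SL_mul A B : SL K n := MkSL (SL_mul_det A B).
Definition SL_inv A : SL K n := MkSL (SL_inv_det A).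

Fact SL_mulA : associative SL_mul.
Proof. by move=> A B C; apply: val_inj; rewrite /= mulmxA. Qed.
Fact SL_mul1 : left_id SL_one SL_mul.
Proof. by move=> A; apply: val_inj; rewrite /= mul1mx. Qed.
Fact SL_mulr1 : right_id SL_one SL_mul.
Proof. by move=> A; apply: val_inj; rewrite /= mulmx1. Qed.
Fact SL_mulV : left_inverse SL_one SL_inv SL_mul.
Proof. by move=> A; apply: val_inj; rewrite /= mulVmx ?SL_unitmx. Qed.
Fact SL_mulrV : right_inverse SL_one SL_inv SL_mul.
Proof. by move=> A; apply: val_inj; rewrite /= mulmxV ?SL_unitmx. Qed.

HB.instance Definition _ := isGroup.Build (SL K n)
  SL_mulA SL_mul1 SL_mulr1 SL_mulV SL_mulrV.

HB.instance Definition _ :=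
  Topological.copy (SL K n) (initial_topology (@SLmx K n)).

(* Two matrices of SL(n, K) are proportional iff they differ by a scalar
   matrix of SL(n, K), i.e. by an element of the center. *)
Definition SL_proj_rel : rel (SL K n) := fun A B => proportional A B.

Fact SL_proj_rel_refl : reflexive SL_proj_rel.
Proof. by move=> A; exact: proportional_refl. Qed.
Fact SL_proj_rel_sym : ssrbool.symmetric SL_proj_rel.
Proof. by move=> A B; exact: proportional_sym. Qed.
Fact SL_proj_rel_trans : transitive SL_proj_rel.
Proof. by move=> B A C; exact: proportional_trans. Qed.

Canonical SL_proj_equiv :=
  EquivRel SL_proj_rel SL_proj_rel_refl SL_proj_rel_sym SL_proj_rel_trans.

End SpecialLinear.

Definition PSL (K : numClosedFieldType) (n : nat) : Type :=
  quotient_topology {eq_quot (@SL_proj_equiv K n)}.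

Section ProjectiveSpecialLinear.
Context {K : numClosedFieldType} {n : nat}.
Local Notation Q := (quotient_topology {eq_quot (@SL_proj_equiv K n)}).
Implicit Types (A B : SL K n) (g h k : PSL K n).

HB.instance Definition _ := Quotient.copy (PSL K n) Q.
HB.instance Definition _ := Topological.copy (PSL K n) Q.

Lemma PSL_eqP A B :
  reflect (\pi_(PSL K n) A = \pi_(PSL K n) B) (proportional A B).
Proof. exact: (@eqmodP _ (@SL_proj_equiv K n)). Qed.

Lemma PSL_reprP A : proportional (repr (\pi_(PSL K n) A)) A.
Proof. by apply/PSL_eqP; rewrite reprK. Qed.

Definition PSL_one : PSL K n := \pi_(PSL K n) (1%g : SL K n).
Definition PSL_mul g h : PSL K n := \pi_(PSL K n) (repr g * repr h)%g.
Definition PSL_inv g : PSL K n := \pi_(PSL K n) (repr g)^-1%g.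

Lemma pi_PSL_mul A B : PSL_mul (\pi A) (\pi B) = \pi_(PSL K n) (A * B)%g.
Proof. by apply/PSL_eqP; apply: proportional_mul; exact: PSL_reprP. Qed.

Lemma pi_PSL_inv A : PSL_inv (\pi A) = \pi_(PSL K n) (A^-1)%g.
Proof.
by apply/PSL_eqP; apply: proportional_inv (PSL_reprP A); exact: SL_unitmx.
Qed.

Fact PSL_mulA : associative PSL_mul.
Proof.
elim/quotW=> A; elim/quotW=> B; elim/quotW=> C.
by rewrite (pi_PSL_mul B C) (pi_PSL_mul A B) !pi_PSL_mul mulgA.
Qed.
Fact PSL_mul1 : left_id PSL_one PSL_mul.
Proof. by elim/quotW=> A; rewrite (pi_PSL_mul 1%g A) mul1g. Qed.
Fact PSL_mulr1 : right_id PSL_one PSL_mul.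
Proof. by elim/quotW=> A; rewrite (pi_PSL_mul A 1%g) mulg1. Qed.
Fact PSL_mulV : left_inverse PSL_one PSL_inv PSL_mul.
Proof. by elim/quotW=> A; rewrite pi_PSL_inv (pi_PSL_mul A^-1%g A) mulVg. Qed.
Fact PSL_mulrV : right_inverse PSL_one PSL_inv PSL_mul.
Proof. by elim/quotW=> A; rewrite pi_PSL_inv (pi_PSL_mul A A^-1%g) mulgV. Qed.

HB.instance Definition _ := isGroup.Build (PSL K n)
  PSL_mulA PSL_mul1 PSL_mulr1 PSL_mulV PSL_mulrV.

End ProjectiveSpecialLinear.

Record nzvec (K : numClosedFieldType) (n : nat) :=
  NzVec { nzval :> 'cV[K]_n; nzvec_neq0 : nzval != 0 }.

Section ProjectiveSpace.
Context {K : numClosedFieldType} {n : nat}.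

HB.instance Definition _ := [isSub for @nzval K n].
HB.instance Definition _ := [Choice of nzvec K n by <:].

Definition nzvec_rel : rel (nzvec K n) := fun u v => proportional u v.

Fact nzvec_rel_refl : reflexive nzvec_rel.
Proof. by move=> u; exact: proportional_refl. Qed.
Fact nzvec_rel_sym : ssrbool.symmetric nzvec_rel.
Proof. by move=> u v; exact: proportional_sym. Qed.
Fact nzvec_rel_trans : transitive nzvec_rel.
Proof. by move=> v u w; exact: proportional_trans. Qed.

Canonical nzvec_equiv :=
  EquivRel nzvec_rel nzvec_rel_refl nzvec_rel_sym nzvec_rel_trans.

End ProjectiveSpace.

(* The projectivization of K^n, of dimension n - 1: the plane is Proj K 3. *)
Definition Proj (K : numClosedFieldType) (n : nat) : Type :=
  {eq_quot (@nzvec_equiv K n)}.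

Section ProjectiveAction.
Context {K : numClosedFieldType} {n : nat}.
Local Notation Q := {eq_quot (@nzvec_equiv K n)}.
Implicit Types (A : SL K n) (u v : nzvec K n) (g : PSL K n) (p : Proj K n).

HB.instance Definition _ := EqQuotient.copy (Proj K n) Q.
HB.instance Definition _ := Choice.copy (Proj K n) Q.

Lemma Proj_eqP u v :
  reflect (\pi_(Proj K n) u = \pi_(Proj K n) v) (proportional u v).
Proof. exact: (@eqmodP _ (@nzvec_equiv K n)). Qed.

Fact SL_act_neq0 A v : A *m v != 0.
Proof.
apply: contra (nzvec_neq0 v) => /eqP Av0.
by rewrite -[nzval v](mulKmx (SL_unitmx A)) Av0 mulmx0.
Qed.

Definition SL_act A v : nzvec K n := NzVec (SL_act_neq0 A v).

Definition PSL_act g p : Proj K n := \pi_(Proj K n) (SL_act (repr g) (repr p)).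

Lemma pi_PSL_act A v : PSL_act (\pi A) (\pi v) = \pi_(Proj K n) (SL_act A v).
Proof.
apply/Proj_eqP; apply: proportional_mul; first exact: PSL_reprP.
by apply/Proj_eqP; rewrite reprK.
Qed.

Definition invariant_set (G : set (PSL K n)) (S : set (Proj K n)) :=
  forall g, G g -> PSL_act g @` S = S.

End ProjectiveAction.

Section Subgroups.
Context {T : groupType}.
Implicit Types G H : set T.

Definition subgroup G := group_closed (fun x => x \in G).

(* The set of left cosets g H, for g in G, is finite; used for H inside G. *)
Definition finite_index G H := finite_set [set [set (g * h)%g | h in H] | g in G].

Definition conj_set (g : T) G : set T := [set (g * x * g^-1)%g | x in G].

End Subgroups.

Definition discrete_set (T : topologicalType) (A : set T) := A `<=` isolated A.

Section PlaneGeometry.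
Context {K : numClosedFieldType}.
Implicit Types (L S : set (Proj K 3)) (G : set (PSL K 3)).

Definition zero_locus (F : {mpoly K[3]}) : set (Proj K 3) :=
  [set p | forall v : nzvec K 3, p = \pi v -> F.@[fun i => nzval v i 0] = 0].

(* The form F may be reducible or have repeated factors, so that reducible
   curves are allowed. *)
Definition algebraic_curve S :=
  exists (d : nat) (F : {mpoly K[3]}),
    [/\ (0 < d)%N, F \is d.-homog, F != 0 & S = zero_locus F].

Definition exceptional_algebraic_set G S :=
  algebraic_curve S /\ invariant_set G S.

Definition projective_line L :=
  exists2 a : 'rV[K]_3, a != 0 &
    L = [set p | forall v : nzvec K 3, p = \pi v -> a *m nzval v = 0].

Definition affine_group G := exists2 L, projective_line L & invariant_set G L.

Definition virtually_affine G :=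
  exists H : set (PSL K 3),
    [/\ subgroup H, H `<=` G, finite_index G H & affine_group H].

End PlaneGeometry.

Definition kleinian (K : numClosedFieldType) (Gamma : set (PSL K 2)) :=
  subgroup Gamma /\ discrete_set Gamma.

Section Veronese.
Context {K : numClosedFieldType}.

(* The action of A on the symmetric square of K^2, in the basis
   e1^2, e1 e2, e2^2. *)
Definition iota_mx (A : 'M[K]_2) : 'M[K]_3 :=
  let a := A 0 0 in let b := A 0 1 in let c := A 1 0 in let d := A 1 1 in
  \matrix_(i, j) nth 0 (nth [::]
    [:: [:: a ^+ 2;    a * b;         b ^+ 2   ];
        [:: 2 * a * c; a * d + b * c; 2 * b * d];
        [:: c ^+ 2;    d * c;         d ^+ 2   ]] i) j.

Lemma iota_mxZ (k : K) (A : 'M[K]_2) : iota_mx (k *: A) = k ^+ 2 *: iota_mx A.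
Proof.
apply/matrixP=> i j; rewrite !mxE.
by case: i => -[|[|[|i]]] //= _; case: j => -[|[|[|j]]] //= _; ring.
Qed.

Lemma det_mx2 (A : 'M[K]_2) : \det A = A 0 0 * A 1 1 - A 0 1 * A 1 0.
Proof.
rewrite (expand_det_row _ 0) !big_ord_recl big_ord0 /cofactor !det_mx11 !mxE /=.
have -> : lift 0 0 = 1 :> 'I_2 by exact/val_inj.
have -> : lift 1 0 = 0 :> 'I_2 by exact/val_inj.
ring.
Qed.

Lemma det_iota_mx (A : 'M[K]_2) : \det (iota_mx A) = \det A ^+ 3.
Proof.
rewrite (expand_det_row _ 0) !big_ord_recl big_ord0 /cofactor.
rewrite !det_mx2 !mxE /=; ring.
Qed.

Lemma iota_mxM (A B : 'M[K]_2) : iota_mx (A *m B) = iota_mx A *m iota_mx B.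
Proof.
apply/matrixP=> i j; rewrite !mxE !(big_ord_recl, big_ord0) !mxE /=.
have -> : lift 0 0 = 1 :> 'I_2 by exact/val_inj.
by case: i => -[|[|[|i]]] //= _; case: j => -[|[|[|j]]] //= _; ring.
Qed.

Fact SL_iota_det (A : SL K 2) : \det (iota_mx A) == 1.
Proof. by rewrite det_iota_mx SL_detE expr1n. Qed.

Definition SL_iota (A : SL K 2) : SL K 3 := MkSL (SL_iota_det A).

Definition PSL_iota (g : PSL K 2) : PSL K 3 := \pi_(PSL K 3) (SL_iota (repr g)).

Lemma pi_PSL_iota (A : SL K 2) : PSL_iota (\pi A) = \pi_(PSL K 3) (SL_iota A).
Proof.
apply/PSL_eqP/proportionalP => /=.
have /proportionalP[c c0 ->] := PSL_reprP A.
by exists (c ^+ 2); rewrite ?expf_neq0 ?iota_mxZ.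
Qed.

End Veronese.

(* Main.v *)
(* Let Z(F) be the invariant curve. Forms g of a given degree with Z(g)
   contained in Z(F) are finite in number up to scalars, so F has a finite orbit
   in the projective space of forms under G. Take a form f of least positive
   degree m with a finite orbit. All factors of f have a finite orbit as well,
   so f is irreducible; and no point p has a finite orbit when m >= 2, since the
   polar D_p f would be a form of degree m - 1 with a finite orbit.
   - If m = 1, then a line has a finite orbit and G is virtually affine.
   - If m >= 3, then f meets its Hessian (weak Bezout) in finitely many points
     (f does not divide its Hessian, as one sees by restricting both to the
     tangent line at a smooth point); these flexes have finite orbits, which is
     impossible.
   - If m = 2, then f is a nondegenerate conic. It is fixed by G, for otherwise
     the pencil spanned by f and another conic of its orbit contains a degenerate
     conic with a finite orbit. Hence G is conjugate into the stabilizer of the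
     Veronese conic, which is the image of iota. *)
Require Import Defs.
From mathcomp Require Import all_boot all_order all_algebra complex.
From mathcomp Require Import mpoly ring.
From mathcomp Require Import boolp classical_sets functions cardinality.
From mathcomp Require Import reals topology normedtype.

Set Implicit Arguments.
Unset Strict Implicit.
Unset Printing Implicit Defensive.

Import GRing.Theory Num.Theory.
Import numFieldNormedType.Exports.

Local Open Scope classical_set_scope.
Local Open Scope ring_scope.
Local Open Scope quotient_scope.

(** * Evaluation and substitution in multivariate polynomials *)

Section MPolyGeneralities.
Context (K : numClosedFieldType) (n : nat).
Implicit Types (F G : {mpoly K[n]}) (v w : 'cV[K]_n).

(** [G] is not cut down to a subgroup along the way: a finite orbit up to scalars, unlike
    invariance, is inherited by factors, by polars at points with a finite orbit and by degenerate
    members of pencils. A stabilizer is taken only at the end, for a line. Orbits are those of the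
    full lift of [G] to SL(3), which acts on forms by linear substitutions. Bezout's theorem enters
    as two separate statements. Finiteness of common zeros comes from elimination: in a chart an
    irreducible form stays irreducible over K(x), so with any form it does not divide it satisfies a
    Bezout relation whose right side is a nonzero polynomial in x alone. Existence of a common zero
    comes from the resultant in z, a form of positive degree in x and y. Together they show that a
    curve has infinitely many points, which yields smooth points, and that flexes exist but are
    finite in number. *)

Lemma mpoly_ring_ind (P : {mpoly K[n]} -> Prop) :
  (forall c, P c%:MP) -> (forall i, P 'X_i) ->
  (forall F G, P F -> P G -> P (F + G)) ->
  (forall F G, P F -> P G -> P (F * G)) -> forall F, P F.
Proof.
move=> PC PX PD PM F; rewrite [F]mpolyE.
apply: (big_ind P) => [|//|m _]; first by rewrite -mpolyC0.
rewrite -mul_mpolyC; apply: (PM _ _ (PC _)).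
rewrite mpolyXE_id; apply: (big_ind P) => [|//|i _]; first by rewrite -mpolyC1.
elim: (m i) => [|k IH]; first by rewrite expr0 -mpolyC1.
by rewrite exprS; apply: PM.
Qed.

Lemma rmorph_mmap (S T : comNzRingType) (phi : {rmorphism K -> S})
    (psi : {rmorphism S -> T}) (h : 'I_n -> S) F :
  psi (mmap phi h F) = mmap (psi \o phi) (psi \o h) F.
Proof.
rewrite /mmap rmorph_sum; apply: eq_bigr => m _.
rewrite rmorphM /mmap1 rmorph_prod; congr (_ * _).
by apply: eq_bigr => i _; rewrite rmorphXn.
Qed.

Lemma eq_mmap (S : comNzRingType) (f g : K -> S) (h k : 'I_n -> S) F :
  f =1 g -> h =1 k -> mmap f h F = mmap g k F.
Proof.
move=> fg hk; rewrite /mmap; apply: eq_bigr => m _.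
by rewrite fg (mmap1_eq _ hk).
Qed.

Lemma mmapXU (S : comNzRingType) (phi : {rmorphism K -> S}) (h : 'I_n -> S) i :
  mmap phi h 'X_i = h i.
Proof. by rewrite mmapX mmap1U. Qed.

Lemma mmap_homogZ (S : comNzRingType) (phi : {rmorphism K -> S})
    (h : 'I_n -> S) c d F :
  F \is d.-homog -> mmap phi (fun i => c * h i) F = c ^+ d * mmap phi h F.
Proof.
move=> /dhomogP homF; rewrite /mmap mulr_sumr !big_seq.
apply: eq_bigr => m mF; rewrite mulrCA; congr (_ * _); rewrite /mmap1.
rewrite (eq_bigr _ (fun i _ => exprMn _ _ _)) big_split /=; congr (_ * _).
by have /= <- := homF _ mF; rewrite prodrXr mdegE.
Qed.

Lemma horner_mmap (h : 'I_n -> {poly K}) F t :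
  (mmap polyC h F).[t] = F.@[fun i => (h i).[t]].
Proof.
rewrite -[LHS]/(horner_eval t _) rmorph_mmap; apply: eq_mmap => //= c.
exact: hornerC.
Qed.

Lemma deriv_mmap (h : 'I_n -> {poly K}) F :
  (mmap polyC h F)^`() = \sum_i mmap polyC h F^`M(i) * (h i)^`().
Proof.
elim/mpoly_ring_ind: F => [c|j|F G IF IG|F G IF IG].
- rewrite mmapC derivC big1 // => i _; by rewrite mderivC mmap0 mul0r.
- rewrite mmapXU (bigD1 j) //= big1 ?addr0 => [|i ij]; rewrite mderivX mnm1E.
    rewrite eqxx scale1r -{1}[(U_(j))%MM]addm0 addmC addmK.
    by rewrite mpolyX0 rmorph1 mul1r.
  by rewrite eq_sym (negPf ij) scale0r mmap0 mul0r.
- rewrite mmapD derivD IF IG -big_split /=; apply: eq_bigr => i _.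
  by rewrite mderivD mmapD mulrDl.
- rewrite rmorphM derivM IF IG mulr_suml mulr_sumr -big_split /=.
  apply: eq_bigr => i _; rewrite mderivM mmapD !rmorphM /=; ring.
Qed.

End MPolyGeneralities.

(** In characteristic 0 the [size p] distinct naturals [i%:R] would be one root too many. *)
Lemma poly_eq0_horner (K : numClosedFieldType) (p : {poly K}) :
  (forall t, p.[t] = 0) -> p = 0.
Proof.
move=> p0; apply: contrapT => /eqP pN0.
have := @max_poly_roots _ p [seq i%:R | i <- iota 0 (size p)] pN0.
rewrite size_map size_iota ltnn => H; apply: notF; apply: H.
  by apply/allP => x _; apply/rootP.
by rewrite map_inj_uniq ?iota_uniq // => i j /eqP; rewrite eqr_nat => /eqP.
Qed.

Definition mev {K : numClosedFieldType} {n} (F : {mpoly K[n]}) (v : 'cV[K]_n) : K :=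
  F.@[fun i => v i 0].

Section Evaluation.
Context (K : numClosedFieldType) (n : nat).
Implicit Types (F G : {mpoly K[n]}) (v w : 'cV[K]_n).

Lemma mevD F G v : mev (F + G) v = mev F v + mev G v. Proof. exact: mevalD. Qed.
Lemma mevB F G v : mev (F - G) v = mev F v - mev G v. Proof. exact: mevalB. Qed.
Lemma mevM F G v : mev (F * G) v = mev F v * mev G v. Proof. exact: mevalM. Qed.
Lemma mevZ c F v : mev (c *: F) v = c * mev F v. Proof. exact: mevalZ. Qed.
Lemma mevC c v : mev c%:MP v = c. Proof. exact: mevalC. Qed.
Lemma mev0 v : mev 0 v = 0. Proof. exact: meval0. Qed.
Lemma mev_sum (I : Type) (r : seq I) (P : pred I) (E : I -> {mpoly K[n]}) v :
  mev (\sum_(i <- r | P i) E i) v = \sum_(i <- r | P i) mev (E i) v.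
Proof. exact: (rmorph_sum (meval _)). Qed.
Lemma mev_prod (I : Type) (r : seq I) (P : pred I) (E : I -> {mpoly K[n]}) v :
  mev (\prod_(i <- r | P i) E i) v = \prod_(i <- r | P i) mev (E i) v.
Proof. exact: (rmorph_prod (meval _)). Qed.
Lemma mevX i v : mev 'X_i v = v i 0. Proof. exact: mevalXU. Qed.

Lemma mev_homogZ d F c v : F \is d.-homog -> mev F (c *: v) = c ^+ d * mev F v.
Proof.
move=> hF; rewrite -(mmap_homogZ idfun _ _ hF).
by apply: eq_mmap => // i; rewrite mxE.
Qed.

Lemma mev_homog0 d F : (0 < d)%N -> F \is d.-homog -> mev F 0 = 0.
Proof.
by move=> d0 hF; rewrite -(scale0r 0) (mev_homogZ _ _ hF) expr0n gtn_eqF ?mul0r.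
Qed.

Lemma mev_at0 F : mev F 0 = F@_0%MM.
Proof.
elim/mpoly_ring_ind: F => [c|j|F G IF IG|F G IF IG].
- by rewrite mevC mcoeffC eqxx mulr1.
- by rewrite mevX mxE mcoeffX -mdeg_eq0 mdeg1.
- by rewrite mevD mcoeffD IF IG.
- by rewrite mevM rmorphM IF IG.
Qed.

(* All derivatives of F vanish identically as well, hence so does every
   coefficient of its Taylor expansion at 0. *)
Lemma mpoly_eq0_mev F : (forall v, mev F v = 0) -> F = 0.
Proof.
have der0 G : (forall v, mev G v = 0) -> forall i v, mev G^`M(i) v = 0.
  move=> G0 i v; pose h j : {poly K} := (v j 0)%:P + (j == i)%:R *: 'X.
  have G'0 : mmap polyC h G = 0.
    apply: poly_eq0_horner => t; rewrite horner_mmap.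
    rewrite -[RHS](G0 (\col_j (h j).[t])); apply: eq_mmap => // j.
    by rewrite !mxE.
  have := congr1 (fun p => p^`().[0]) G'0.
  rewrite deriv_mmap deriv0 horner0 horner_sum (bigD1 i) //= big1 => [|j ji].
    rewrite addr0 hornerM derivD derivC derivZ derivX eqxx scale1r add0r.
    rewrite hornerC mulr1 horner_mmap => <-; apply: eq_mmap => // j.
    by rewrite /h !hornerE.
  by rewrite hornerM derivD derivC derivZ (negPf ji) scale0r addr0 horner0 mulr0.
have der0m G : (forall v, mev G v = 0) -> forall m v, mev G^`M[m] v = 0.
  move=> G0 m; rewrite /mderivm; elim: (enum _) => //=.
  by move=> i s IH; elim: (m i) => //= k IHk v; apply: der0.
move=> F0; apply/mpolyP => m; rewrite mcoeff0.
have := der0m F F0 m 0; rewrite mev_at0 mcoeff_mderivm addm0 => /eqP.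
rewrite mulrn_eq0 -leqn0 leqNgt => /orP[/negP[]|/eqP//].
by apply: prodn_gt0 => i; rewrite ffactnn fact_gt0.
Qed.

End Evaluation.
Lemma mpoly_mevP (K : numClosedFieldType) n (F G : {mpoly K[n]}) :
  (forall v, mev F v = mev G v) -> F = G.
Proof.
move=> FG; apply/eqP; rewrite -subr_eq0; apply/eqP/mpoly_eq0_mev => v.
by rewrite mevB FG subrr.
Qed.

Lemma mpoly_neq0_mev (K : numClosedFieldType) n (F : {mpoly K[n]}) :
  F != 0 -> exists v, mev F v != 0.
Proof.
move=> F0; apply: contrapT => nex; case/eqP: F0; apply: mpoly_eq0_mev => v.
by apply: contrapT => /eqP Fv; apply: nex; exists v.
Qed.

Section Homogeneous.
Context (K : numClosedFieldType) (n : nat).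
Implicit Types (F G Q L : {mpoly K[n]}) (v w : 'cV[K]_n).

Lemma pihomogM d e L Q : L \is d.-homog ->
  pihomog mdeg e (L * Q) = if (d <= e)%N then L * pihomog mdeg (e - d) Q else 0.
Proof.
move=> hL; rewrite {1}(pihomog_partitionE (leqnn (mmeasure mdeg Q))).
rewrite mulr_sumr raddf_sum /=.
have hLQ k : L * pihomog mdeg k Q \is (d + k).-homog.
  by apply: dhomogM => //; apply: pihomogP.
case: leqP => de; last first.
  apply: big1 => k _; apply: pihomog_ne0 (hLQ k).
  by rewrite gtn_eqF // (leq_trans de) ?leq_addr.
have [lt|ge] := ltnP (e - d) (mmeasure mdeg Q).
  rewrite (bigD1 (Ordinal lt)) //= big1 ?addr0 => [|k kN].
    by rewrite pihomog_dE //= -{2}(subnKC de) hLQ.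
  apply: pihomog_ne0 (hLQ k); apply: contra kN => /eqP dk.
    by apply/eqP/val_inj; rewrite /= -dk addKn.
rewrite big1 => [|k _]; last first.
  apply: pihomog_ne0 (hLQ k); apply/eqP => dk.
  by have := leq_trans (ltn_ord k) ge; rewrite -dk addKn ltnn.
rewrite (_ : pihomog _ _ _ = 0) ?mulr0 // pihomogE big_seq_cond big_pred0 // => m.
apply/negbTE/negP => /andP[mQ /eqP /= md].
by have := msize_mdeg_lt mQ; rewrite md ltnNge ge.
Qed.

(** Multiplication by [L] shifts homogeneous components by [d]; cancelling [L] in the component of
    degree [e] leaves [Q] equal to one of its own components. *)
Lemma dhomog_div d e L Q : L \is d.-homog -> L * Q != 0 ->
  L * Q \is e.-homog -> (d <= e)%N /\ Q \is (e - d).-homog.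
Proof.
move=> hL LQ0 hLQ; have := pihomog_dE hLQ; rewrite (pihomogM _ _ hL).
case: leqP => [de|_ /esym/eqP]; last by rewrite (negPf LQ0).
have L0 : L != 0 by apply: contraNneq LQ0 => ->; rewrite mul0r.
by move=> /(mulfI L0) <-; split=> //; apply: pihomogP.
Qed.

Lemma dhomog0_const F : F \is 0.-homog -> F = (F@_0%MM)%:MP.
Proof.
move=> /dhomogP hF; apply/mpolyP => m; rewrite mcoeffC.
case: eqVneq => [<-|m0]; first by rewrite mulr1.
rewrite mulr0; apply/eqP; rewrite mcoeff_eq0; apply: contra m0 => /hF /eqP.
by rewrite mdeg_eq0 eq_sym.
Qed.

Lemma dhomog_prodX (L : 'I_n -> {mpoly K[n]}) (m : 'I_n -> nat) (r : seq 'I_n) :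
  (forall i, L i \is 1.-homog) ->
  \prod_(i <- r) L i ^+ m i \is (\sum_(i <- r) m i)%N.-homog.
Proof.
move=> hL; elim: r => [|i r IH]; first by rewrite !big_nil dhomog1.
rewrite !big_cons; apply: dhomogM IH.
by rewrite -[X in X.-homog]mul1n; apply: dhomogMn.
Qed.

Definition linform (a : 'rV[K]_n) : {mpoly K[n]} := \sum_j a 0 j *: 'X_j.

Lemma mev_linform a v : mev (linform a) v = (a *m v) 0 0.
Proof. by rewrite mev_sum mxE; apply: eq_bigr => j _; rewrite mevZ mevX. Qed.

Lemma linform_homog a : linform a \is 1.-homog.
Proof.
by apply: rpred_sum => j _; apply: dhomogZ; rewrite dhomogX /= mdeg1.
Qed.

Lemma linform_eq0 a : (linform a == 0) = (a == 0).
Proof.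
apply/eqP/eqP => [a0|->]; last by apply: big1 => j _; rewrite mxE scale0r.
apply/rowP => j; have := congr1 (fun F => mev F (delta_mx j 0)) a0.
rewrite mev_linform mev0 mxE (bigD1 j) //= big1 => [|k kj].
  by rewrite !mxE !eqxx mulr1 addr0.
by rewrite !mxE (negPf kj) mulr0.
Qed.

(** Substitution is a right action of matrices ([mcomp_comp]); accordingly a matrix moves zero loci
    by composing with its inverse. *)
Definition mcomp (A : 'M[K]_n) F := F \mPo [tuple linform (row i A) | i < n].

Lemma mev_comp A F v : mev (mcomp A F) v = mev F (A *m v).
Proof.
rewrite /mev comp_mpoly_meval; apply: meval_eq => i.
rewrite tnth_mktuple -/(mev _ _) mev_linform -row_mul mxE.
by [].
Qed.

Lemma mcomp_homog d A F : F \is d.-homog -> mcomp A F \is d.-homog.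
Proof.
move=> /dhomogP hF; rewrite /mcomp comp_mpolyEX big_seq.
apply: rpred_sum => m /hF /= <-; apply: dhomogZ.
rewrite comp_mpolyX mdegE; apply: dhomog_prodX => i.
by rewrite tnth_mktuple linform_homog.
Qed.

Lemma mcompM A F G : mcomp A (F * G) = mcomp A F * mcomp A G.
Proof. by apply: mpoly_mevP => v; rewrite mevM !mev_comp mevM. Qed.

Lemma mcompZ A c F : mcomp A (c *: F) = c *: mcomp A F.
Proof. by apply: mpoly_mevP => v; rewrite mevZ !mev_comp mevZ. Qed.

Lemma mcompB A F G : mcomp A (F - G) = mcomp A F - mcomp A G.
Proof. by apply: mpoly_mevP => v; rewrite mevB !mev_comp mevB. Qed.

Lemma mcomp_comp A B F : mcomp A (mcomp B F) = mcomp (B *m A) F.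
Proof. by apply: mpoly_mevP => v; rewrite !mev_comp mulmxA. Qed.

Lemma mcomp1 F : mcomp 1%:M F = F.
Proof. by apply: mpoly_mevP => v; rewrite mev_comp mul1mx. Qed.

Lemma mcompK A : A \in unitmx -> cancel (mcomp A) (mcomp (invmx A)).
Proof. by move=> uA F; rewrite mcomp_comp mulmxV // mcomp1. Qed.

Lemma mcompVK A : A \in unitmx -> cancel (mcomp (invmx A)) (mcomp A).
Proof. by move=> uA F; rewrite mcomp_comp mulVmx // mcomp1. Qed.

Lemma mcomp_eq0 A F : A \in unitmx -> (mcomp A F == 0) = (F == 0).
Proof.
move=> uA; rewrite -[in RHS](can_eq (mcompK uA)); congr (_ == _).
by apply: mpoly_mevP => v; rewrite mev_comp !mev0.
Qed.

End Homogeneous.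

Section TopCoefficient.
Context (S : comNzRingType).

(** The bounds [d] and [e] need not be sharp: a top coefficient may vanish. *)
Lemma coefM_top (p q : {poly S}) d e : (size p <= d.+1)%N -> (size q <= e.+1)%N ->
  (size (p * q)%R <= (d + e).+1)%N /\ (p * q)`_(d + e) = p`_d * q`_e.
Proof.
move=> sp sq; split.
  apply: leq_trans (size_polyMleq _ _) _.
  by rewrite -subn1 leq_subLR add1n (leq_trans (leq_add sp sq)) // addSn addnS.
have dlt : (d < (d + e).+1)%N by rewrite ltnS leq_addr.
rewrite coefM (bigD1 (Ordinal dlt)) //= big1 ?addr0 ?addKn // => j jd.
have [jlt|jge] := ltnP j d.
  rewrite [q`_ _]nth_default ?mulr0 // (leq_trans sq) //.
  by rewrite ltn_subRL ltn_add2r.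
rewrite [p`_ _]nth_default ?mul0r // (leq_trans sp) // ltn_neqAle jge andbT.
by apply: contra jd => /eqP jd; apply/eqP/val_inj.
Qed.

Context (K : numClosedFieldType) (n : nat) (phi : {rmorphism K -> S}).

(** Stated over a ring [S] to serve twice: with [S = K] for restrictions to lines, and with [S =
    K[x]] for the chart y = 1. *)
Lemma mmap_affine_top (a b : 'I_n -> S) d (F : {mpoly K[n]}) : F \is d.-homog ->
  let p := mmap (polyC \o phi) (fun i => (a i)%:P + b i *: 'X) F in
  (size p <= d.+1)%N /\ p`_d = mmap phi b F.
Proof.
move=> /dhomogP hF /=; set h := fun i => _.
have hX (r : seq 'I_n) m :
    (size (\prod_(i <- r) h i ^+ m i)%R <= (\sum_(i <- r) m i).+1)%N /\
    (\prod_(i <- r) h i ^+ m i)`_(\sum_(i <- r) m i)%N = \prod_(i <- r) b i ^+ m i.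
  elim: r => [|i r [IH1 IH2]]; first by rewrite !big_nil size_poly1 coef1.
  rewrite !big_cons.
  have [s1 c1] : (size (h i ^+ m i)%R <= (m i).+1)%N /\ (h i ^+ m i)`_(m i) = b i ^+ m i.
    elim: (m i) => [|k [IHs IHc]]; first by rewrite !expr0 size_poly1 coef1.
    have s0 : (size (h i) <= 2)%N.
      rewrite (leq_trans (size_polyD _ _)) // geq_max (leq_trans (size_polyC_leq1 _)) //.
      by rewrite (leq_trans (size_scale_leq _ _)) ?size_polyX.
    rewrite !exprS -add1n; have [-> ->] := coefM_top s0 IHs; split=> //.
    by rewrite IHc /h coefD coefC coefZ coefX /= add0r mulr1.
  by have [-> ->] := coefM_top s1 IH1; rewrite c1 IH2.
rewrite /mmap; split.
  apply: (leq_trans (size_sum _ _ _)); apply/bigmax_leqP_seq => m mF _.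
  rewrite mul_polyC (leq_trans (size_scale_leq _ _)) //.
  by have [+ _] := hX (index_enum 'I_n) m; rewrite -mdegE (hF _ mF).
rewrite coef_sum !big_seq; apply: eq_bigr => m mF.
rewrite mul_polyC coefZ; congr (_ * _).
by have [_ +] := hX (index_enum 'I_n) m; rewrite -mdegE (hF _ mF).
Qed.

End TopCoefficient.

Section LineRestriction.
Context (K : numClosedFieldType) (n : nat).
Implicit Types (F G : {mpoly K[n]}) (u v w : 'cV[K]_n).

Definition lres F u w : {poly K} :=
  mmap polyC (fun i => (u i 0)%:P + w i 0 *: 'X) F.

Lemma horner_lres F u w t : (lres F u w).[t] = mev F (u + t *: w).
Proof.
rewrite horner_mmap; apply: meval_eq => i.
by rewrite !hornerE !mxE mulrC.
Qed.

Lemma lres_top F u w d : F \is d.-homog ->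
  (size (lres F u w) <= d.+1)%N /\ (lres F u w)`_d = mev F w.
Proof.
move=> hF; have := mmap_affine_top idfun (fun i => u i 0) (fun i => w i 0) hF.
by [].
Qed.

Lemma lres_size F u w d : F \is d.-homog -> mev F w != 0 ->
  size (lres F u w) = d.+1.
Proof.
move=> hF Fw; have [s c] := lres_top u w hF.
apply/eqP; rewrite eqn_leq s ltnNge; apply: contra Fw => sd.
by rewrite -c nth_default.
Qed.

End LineRestriction.
(** * Forms vanishing inside a given curve *)

Section ProjectivelyFinite.
Context (K : fieldType) (V : lmodType K).
Implicit Types (A B : V -> Prop).

(** Finiteness of the image in projective space. The representatives in [s] need not satisfy [A],
    which keeps unions and inclusions immediate. *)
Definition proj_finite A := exists s : seq V, forall x, A x ->
  exists2 c : K, c != 0 & exists2 y, y \in s & x = c *: y.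

Lemma proj_finiteS A B : (forall x, A x -> B x) -> proj_finite B -> proj_finite A.
Proof. by move=> AB [s sP]; exists s => x /AB /sP. Qed.

End ProjectivelyFinite.

Lemma proj_finite_bigcup (K : fieldType) (V W : lmodType K) (s : seq V)
    (A : V -> W -> Prop) :
  (forall x, x \in s -> proj_finite (A x)) ->
  proj_finite (fun y => exists2 x, x \in s & A x y).
Proof.
elim: s => [|x s IH] As; first by exists [::] => y [].
have [r rP] := As x (mem_head _ _).
have [|t tP] := IH; first by move=> y ys; apply: As; rewrite inE ys orbT.
exists (r ++ t) => y [z]; rewrite inE => /orP[/eqP->|zs] Ay.
  by have [c c0 [w wr ->]] := rP _ Ay; exists c => //; exists w; rewrite ?mem_cat ?wr.
have [|c c0 [w wr ->]] := tP y; first by exists z.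
by exists c => //; exists w; rewrite ?mem_cat ?wr ?orbT.
Qed.

Section Pigeonhole.
Context (K : numClosedFieldType) (n : nat).
Implicit Types (F g : {mpoly K[n]}) (v w : 'cV[K]_n).

(** A point where the product of the differences of [N + 1] distinct members of [A] does not vanish
    separates them all, against the bound on values there. *)
Lemma pigeonhole_mpoly (N : nat) (A : set {mpoly K[n]}) :
  (forall v, exists2 s : seq K, (size s <= N)%N & forall g, A g -> mev g v \in s) ->
  finite_set A.
Proof.
move=> AN; apply: contrapT => infA.
have [B BA BN] := infinite_set_fset N.+1 infA.
pose r := finmap.enum_fset B; have ru : uniq r := finmap.fset_uniq B.
have [v Dv] : exists v, mev (\prod_(p <- [seq (p, q) | p <- r, q <- r] | p.1 != p.2)
                               (p.1 - p.2)) v != 0.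
  by apply: mpoly_neq0_mev; rewrite prodf_seq_neq0; apply/allP => -[p q] _;
    apply/implyP => /= pq; rewrite subr_eq0.
have [s sN sP] := AN v.
have vu : uniq [seq mev g v | g <- r].
  rewrite map_inj_in_uniq // => p q pr qr epq; apply/eqP/negP => /negP pq.
  move: Dv; rewrite mev_prod prodf_seq_neq0 => /allP/(_ (p, q)).
  by rewrite allpairs_f //= pq mevB epq subrr eqxx => /(_ isT).
have : (size [seq mev g v | g <- r] <= size s)%N.
  by apply: uniq_leq_size vu _ => x /mapP[g gr ->]; apply: sP; apply: BA.
by rewrite size_map leqNgt (leq_ltn_trans sN).
Qed.

(** The possible constant coefficients of a monic polynomial of degree [d] with all its roots in
    [s]. *)
Fixpoint root_products (d : nat) (s : seq K) : seq K :=
  if d is d'.+1 then [seq - x * y | x <- s, y <- root_products d' s] else [:: 1].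

Lemma size_root_products d s : size (root_products d s) = (size s ^ d)%N.
Proof. by elim: d => //= d IH; rewrite size_allpairs IH expnS. Qed.

Lemma mem_root_products d s r : size r = d -> {subset r <= s} ->
  \prod_(x <- r) - x \in root_products d s.
Proof.
elim: d r => [|d IH] [|x r] //=; first by rewrite big_nil mem_head.
move=> [sr] rs; rewrite big_cons; apply: (allpairs_f (fun x y => - x * y)).
  by apply: rs; rewrite mem_head.
by apply: IH => // y yr; apply: rs; rewrite inE yr orbT.
Qed.

(* With v0 outside the zero locus of F and g(v0) = 1, the polynomial
   g(w + t v0) is monic of degree d with roots among those of F(w + t v0),
   which leaves at most e ^ d values for its constant coefficient g(w). *)
Lemma proj_finite_zero_locus_sub d e F : (0 < e)%N -> F \is e.-homog -> F != 0 ->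
  proj_finite (fun g => [/\ g \is d.-homog, g != 0 &
    forall v, v != 0 -> mev g v = 0 -> mev F v = 0]).
Proof.
move=> e0 hF F0; have [v0 Fv0] := mpoly_neq0_mev F0.
have v00 : v0 != 0 by apply: contraNneq Fv0 => ->; rewrite (mev_homog0 e0 hF).
pose A : set {mpoly K[n]} := [set g | [/\ g \is d.-homog, mev g v0 = 1 &
  forall v, v != 0 -> mev g v = 0 -> mev F v = 0]].
have finA : finite_set A.
  apply: (@pigeonhole_mpoly (e ^ d)) => w.
  have [s sE] := closed_field_poly_normal (lres F w v0).
  have s0 := lres_size w hF Fv0.
  have Fl0 : lead_coef (lres F w v0) != 0 by rewrite lead_coef_eq0 -size_poly_eq0 s0.
  have ss : size s = e.
    by move: s0; rewrite sE size_scale // size_prod_XsubC => -[].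
  exists (root_products d s); first by rewrite size_root_products ss.
  move=> g [hg g1 gF]; have [r rE] := closed_field_poly_normal (lres g w v0).
  have gs : size (lres g w v0) = d.+1 by apply: lres_size => //; rewrite g1 oner_neq0.
  have gl : lead_coef (lres g w v0) = 1.
    by rewrite lead_coefE gs /=; have [_ ->] := lres_top w v0 hg.
  rewrite gl scale1r in rE; have sr : size r = d.
    by move: gs; rewrite rE size_prod_XsubC => -[].
  have -> : mev g w = \prod_(x <- r) - x.
    have := horner_lres g w v0 0; rewrite scale0r addr0 => <-.
    by rewrite rE horner_prod; apply: eq_bigr => x _; rewrite !hornerE.
  apply: mem_root_products => // x xr.
  have gx : mev g (w + x *: v0) = 0.
    by rewrite -horner_lres rE; apply/rootP; rewrite root_prod_XsubC.
  have Fx : root (lres F w v0) x.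
    apply/rootP; rewrite horner_lres.
    have [->|] := eqVneq (w + x *: v0) 0; first exact: mev_homog0 hF.
    by move/gF; apply.
  by move: Fx; rewrite sE rootZ // root_prod_XsubC.
have /finite_seqP[s sE] := finA; exists s => g [hg g0 gF].
have gv0 : mev g v0 != 0 by apply: contra Fv0 => /eqP /(gF _ v00) ->.
exists (mev g v0) => //; exists ((mev g v0)^-1 *: g).
  have : A ((mev g v0)^-1 *: g).
    split; [exact: dhomogZ | by rewrite mevZ mulVf |].
    move=> v vn0; rewrite mevZ => /eqP; rewrite mulf_eq0 invr_eq0 (negPf gv0).
    by move=> /eqP; apply: gF.
  by rewrite sE.
by rewrite scalerA mulfV ?scale1r.
Qed.

End Pigeonhole.

(** * Divisibility by linear forms *)

Section LinearFactors.
Context (K : numClosedFieldType) (n : nat).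
Implicit Types (F G Q : {mpoly K[n]}) (v w : 'cV[K]_n) (a : 'rV[K]_n).

Definition mdvd F G := exists Q, G = Q * F.

(** A congruence between two ring morphisms, the identity and the substitution [h], has to be
    checked on the variables only. *)
Lemma linform_dvd_sub a (h : 'I_n -> {mpoly K[n]}) F :
  (forall i, mdvd (linform a) ('X_i - h i)) -> mdvd (linform a) (F - mmap (@mpolyC n K) h F).
Proof.
move=> hX; elim/mpoly_ring_ind: F => [c|i|F G [P eP] [Q eQ]|F G [P eP] [Q eQ]].
- by exists 0; rewrite mmapC subrr mul0r.
- by rewrite mmapXU.
- by exists (P + Q); rewrite mmapD opprD addrACA eP eQ mulrDl.
- exists (P * G + mmap (@mpolyC n K) h F * Q); rewrite rmorphM /= mulrDl.
  rewrite -[mmap _ _ F * Q * _]mulrA -eQ mulrAC -eP; ring.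
Qed.

(** [A] is the projection onto the hyperplane [a = 0] along a vector [u] with [a *m u = 1]. Since
    [X_i - mcomp A X_i] is [u_i] times the linear form, composing with [A] is reduction modulo that
    form. *)
Lemma linform_proj a : a != 0 -> exists A : 'M[K]_n,
  [/\ a *m A = 0, forall v, a *m v = 0 -> A *m v = v &
      forall F, mdvd (linform a) (F - mcomp A F)].
Proof.
move=> /rV0Pn[k ak]; pose u : 'cV[K]_n := (a 0 k)^-1 *: delta_mx k 0.
have au : a *m u = 1%:M.
  apply/matrixP => i j; rewrite !ord1 -scalemxAr -colE !mxE mulVf //=.
exists (1%:M - u *m a); split=> [|v av|F].
- by rewrite mulmxBr mulmx1 mulmxA au mul1mx subrr.
- by rewrite mulmxBl mul1mx -mulmxA av mulmx0 subr0.
apply: linform_dvd_sub => i; exists (u i 0)%:MP.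
rewrite tnth_mktuple; apply: mpoly_mevP => v.
rewrite mevB mevM mevC mevX !mev_linform -row_mul mulmxBl mul1mx -mulmxA !mxE.
by rewrite big_ord1 opprB addrC subrK !mxE.
Qed.

Lemma linform_dvdP a F : a != 0 ->
  mdvd (linform a) F <-> (forall v, a *m v = 0 -> mev F v = 0).
Proof.
move=> a0; split=> [[Q ->] v av|F0].
  by rewrite mevM mev_linform av mxE mulr0.
have [A [aA _ /(_ F)]] := linform_proj a0.
rewrite (_ : mcomp A F = 0) ?subr0 //; apply: mpoly_eq0_mev => v.
by rewrite mev_comp F0 // mulmxA aA mul0mx.
Qed.

(** Linear forms are prime: reduction by the projection takes values in a domain, and whatever it
    kills is a multiple of the linear form. *)
Lemma linform_dvdM a F G : a != 0 ->
  mdvd (linform a) (F * G) -> mdvd (linform a) F \/ mdvd (linform a) G.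
Proof.
move=> a0 /(linform_dvdP _ a0) FG; have [A [aA _ dA]] := linform_proj a0.
have : mcomp A F * mcomp A G = 0.
  rewrite -mcompM; apply: mpoly_eq0_mev => v.
  by rewrite mev_comp FG // mulmxA aA mul0mx.
by move/eqP; rewrite mulf_eq0 => /orP[]/eqP e; [left|right];
  [have := dA F|have := dA G]; rewrite e subr0.
Qed.

(* Gauss' lemma, for a content that is a product of linear forms. *)
Lemma strip_linforms (s : seq 'rV[K]_n) F P Q : all (fun a => a != 0) s ->
  \prod_(a <- s) linform a * F = P * Q ->
  exists s1 s2 P' Q', [/\ {subset s1 <= s}, {subset s2 <= s},
    P = \prod_(a <- s1) linform a * P', Q = \prod_(a <- s2) linform a * Q' &
    F = P' * Q'].
Proof.
elim: s P Q => [|a s IH] P Q /=.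
  by rewrite big_nil mul1r => _ ->; exists [::], [::], P, Q; rewrite !big_nil !mul1r.
case/andP => a0 s0; rewrite big_cons -mulrA => e.
have la0 : linform a != 0 by rewrite linform_eq0.
have [|[R eR]|[R eR]] := @linform_dvdM a P Q a0.
- by rewrite -e; exists (\prod_(j <- s) linform j * F); rewrite mulrC.
- have [|s1 [s2 [P' [Q' [s1s s2s e1 e2 ->]]]]] := IH R Q s0.
    by apply: (mulfI la0); rewrite e eR; ring.
  exists (a :: s1), s2, P', Q'; split; rewrite // ?eR ?e1 ?e2.
  + by move=> x; rewrite !inE => /orP[->//|/s1s ->]; rewrite orbT.
  + by move=> x /s2s; rewrite inE orbC => ->.
  + by rewrite big_cons mulrC mulrA.
- have [|s1 [s2 [P' [Q' [s1s s2s e1 e2 ->]]]]] := IH P R s0.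
    by apply: (mulfI la0); rewrite e eR; ring.
  exists s1, (a :: s2), P', Q'; split; rewrite // ?eR ?e1 ?e2.
  + by move=> x /s1s; rewrite inE orbC => ->.
  + by move=> x; rewrite !inE => /orP[->//|/s2s ->]; rewrite orbT.
  + by rewrite big_cons mulrC mulrA.
Qed.

End LinearFactors.
(** * Common zeros of two plane forms *)

Definition vec3 (S : pzRingType) (x y z : S) : 'cV[S]_3 := \col_i [:: x; y; z]`_i.

Lemma vec3P (S : pzRingType) (v : 'cV[S]_3) : v = vec3 (v 0 0) (v 1 0) (v 2%:R 0).
Proof.
by apply/colP => -[[|[|[|//]]]] ?; rewrite !mxE /=; congr (v _ _); apply: val_inj.
Qed.

Section Dehomogenize.
Context (K : numClosedFieldType).
Implicit Types (F G P Q f h : {mpoly K[3]}) (v : 'cV[K]_3) (a : 'rV[K]_3).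

Definition pt3 (S : pzRingType) (x y z : S) (i : 'I_3) : S := [:: x; y; z]`_i.

Local Notation CC := (@polyC {poly K} \o @polyC K).

(* The restriction to the chart y = 1, as a polynomial in z over K[x]. *)
Definition deh F : {poly {poly K}} := mmap CC (pt3 'X%:P 1 'X) F.

Lemma dehM F G : deh (F * G) = deh F * deh G. Proof. exact: rmorphM. Qed.
Lemma dehB F G : deh (F - G) = deh F - deh G. Proof. exact: mmapB. Qed.
Lemma dehZ c F : deh (c *: F) = c%:P *: deh F.
Proof. by rewrite /deh mmapZ mul_polyC. Qed.
Lemma dehC c : deh c%:MP = c%:P%:P. Proof. exact: mmapC. Qed.
Lemma deh_prod I (r : seq I) (E : I -> {mpoly K[3]}) :
  deh (\prod_(i <- r) E i) = \prod_(i <- r) deh (E i).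
Proof. exact: (rmorph_prod (mmap CC (pt3 'X%:P 1 'X))). Qed.
Lemma dehX i : deh 'X_i = pt3 'X%:P 1 'X i. Proof. exact: mmapXU. Qed.

Lemma horner_deh F x z : (deh F).[z%:P].[x] = mev F (vec3 x 1 z).
Proof.
rewrite -[LHS]/((horner_eval x \o horner_eval z%:P) _) rmorph_mmap.
apply: eq_mmap => [c|i] /=; rewrite /horner_eval ?hornerC ?hornerC //.
by rewrite mxE /pt3; case: i => -[|[|[|//]]] ? /=; rewrite !hornerE.
Qed.

Lemma map_deh F x : map_poly (horner_eval x) (deh F) = lres F (vec3 x 1 0) (vec3 0 0 1).
Proof.
apply/eqP; rewrite -subr_eq0; apply/eqP/poly_eq0_horner => z.
rewrite hornerD hornerN horner_lres -[z in X in X - _](hornerC z x).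
rewrite -[_.[x] in X in X - _]/(horner_eval x z%:P) horner_map /= /horner_eval.
rewrite horner_deh; apply/eqP; rewrite subr_eq0; apply/eqP; congr (mev F _).
by apply/colP => -[[|[|[|//]]]] ?; rewrite !mxE /= ?mulr0 ?mulr1 ?addr0 ?add0r.
Qed.

Lemma deh_top F d : F \is d.-homog ->
  (size (deh F) <= d.+1)%N /\ (deh F)`_d = (mev F (vec3 0 0 1))%:P.
Proof.
move=> hF; have := mmap_affine_top (@polyC K) (pt3 'X 1 0) (pt3 0 0 1) hF.
rewrite -/CC /= (_ : mmap _ _ _ = deh F) => [[-> ->]|]; last first.
  apply: eq_mmap => // -[[|[|[|//]]]] ? /=; rewrite /pt3 /=.
  - by rewrite scale0r addr0.
  - by rewrite scale0r addr0.
  - by rewrite scale1r add0r.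
split=> //; rewrite -[RHS]/(polyC _) rmorph_mmap; apply: eq_mmap => // i.
by rewrite /= mxE /pt3; case: i => -[|[|[|//]]] ?.
Qed.

Lemma deh_size F d : F \is d.-homog -> mev F (vec3 0 0 1) != 0 ->
  size (deh F) = d.+1.
Proof.
move=> hF Fe; have [s c] := deh_top hF.
apply/eqP; rewrite eqn_leq s ltnNge; apply: contra Fe => sd.
by rewrite -polyC_eq0 -c nth_default.
Qed.

Lemma deh_inj F d : F \is d.-homog -> deh F = 0 -> F = 0.
Proof.
(* The chart sees [F] only off the line y = 0, so [X_1 * F] is shown to vanish and [X_1] is
   cancelled. *)
move=> hF F0; apply/eqP; have : 'X_(1 : 'I_3) * F == 0.
  apply/eqP/mpoly_eq0_mev => v; rewrite mevM mevX.
  have [->|v1] := eqVneq (v 1 0) 0; first by rewrite mul0r.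
  rewrite [mev F v](_ : _ = 0) ?mulr0 //.
  have -> : v = v 1 0 *: vec3 (v 0 0 / v 1 0) 1 (v 2%:R 0 / v 1 0).
    rewrite {1}[v]vec3P; apply/colP => -[[|[|[|//]]]] ?; rewrite !mxE /= ?mulr1 //.
      by rewrite mulrC divfK.
    by rewrite mulrC divfK.
  by rewrite (mev_homogZ _ _ hF) -horner_deh F0 !horner0 mulr0.
rewrite mulf_eq0 => /orP[/eqP X0|//].
have := congr1 (fun P => mev P (vec3 0 1 0)) X0.
by rewrite mevX mev0 mxE /= => /eqP; rewrite oner_eq0.
Qed.

(** Powers of y, which [deh] sends to 1, pad a lift to any large enough degree; this freedom lets
    degrees be matched in [homog_relation]. *)
Lemma homogenizeP (p : {poly {poly K}}) : exists N0, forall N, (N0 <= N)%N ->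
  exists2 P, P \is N.-homog & deh P = p.
Proof.
have X_homog (i : 'I_3) : ('X_i : {mpoly K[3]}) \is 1.-homog.
  by rewrite dhomogX /= mdeg1.
have addH (N : nat) P Q p' q' : [/\ P \is N.-homog, Q \is N.-homog, deh P = p' &
    deh Q = q'] -> exists2 R, R \is N.-homog & deh R = p' + q'.
  move=> [hP hQ <- <-]; exists (P + Q); first exact: rpredD.
  exact: mmapD.
elim/poly_ind: p => [|p c [N1 IH]].
  by exists 0%N => N _; exists 0; [exact: dhomog0|exact: mmap0].
have [N2 Hc] : exists N2, forall N, (N2 <= N)%N -> exists2 P, P \is N.-homog & deh P = c%:P.
  elim/poly_ind: c => [|q c [N2 IHc]].
    by exists 0%N => N _; exists 0; [exact: dhomog0|exact: mmap0].
  exists N2.+1 => -[//|N] N2N; have [P hP eP] := IHc N N2N.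
  rewrite polyCD polyCM; apply: (@addH N.+1 (P * 'X_0) (c *: 'X_1 ^+ N.+1)).
  split.
  - by rewrite -(addn1 N); apply: dhomogM.
  - by apply: dhomogZ; rewrite -{2}[N.+1]mul1n; apply: dhomogMn.
  - by rewrite dehM eP dehX.
  - by rewrite dehZ /deh rmorphXn /= -/(deh _) dehX expr1n alg_polyC.
exists (maxn N1 N2).+1 => -[//|N]; rewrite ltnS geq_max => /andP[N1N N2N].
have [P hP eP] := IH N N1N; have [Q hQ eQ] := Hc N.+1 (leqW N2N).
apply: (@addH N.+1 (P * 'X_(2%:R)) Q); split=> //.
- by rewrite -(addn1 N); apply: dhomogM.
- by rewrite dehM eP dehX.
Qed.

Definition row3 (x y z : K) : 'rV[K]_3 := \row_i [:: x; y; z]`_i.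

Lemma deh_row3 x y z : deh (linform (row3 x y z)) = (x *: 'X + y%:P)%:P + z%:P *: 'X.
Proof.
rewrite /linform !(big_ord_recl, big_ord0) /= addr0 !mxE /=.
rewrite -[deh _]/(mmap _ _ _) !mmapD !mmapZ !mmapXU /= /pt3 /= mulr1 addrA.
by rewrite polyCD -!mul_polyC polyCM.
Qed.

(** A relation over K[x] becomes one between forms. A root [x] of [B] yields the linear form
    [X_0 - x X_1], and factors [X_1] balance the degrees; all these linear forms vanish at (0, 0,
    1). *)
Lemma homog_relation h e Q E (p : {poly {poly K}}) (B : {poly K}) : B != 0 ->
  h \is e.-homog -> Q \is E.-homog -> B *: deh h = p * deh Q ->
  exists s c P D, [/\ all (fun a => a != 0) s,
    forall a, a \in s -> exists x y, a = row3 x y 0, c != 0, P \is D.-homog &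
    deh P = p /\ \prod_(a <- s) linform a * (c *: h) = P * Q].
Proof.
move=> B0 hh hQ eB; have [r rE] := closed_field_poly_normal B.
have [N0 /(_ (N0 + (e + size r))%N (leq_addr _ _))[P hP eP]] := homogenizeP p.
(* As [P] has degree [N0 + (e + size r)], this number of factors [X_1] gives both sides the same
   degree. *)
pose t := (N0 + E)%N.
pose s := nseq t (row3 0 1 0) ++ [seq row3 1 (- x) 0 | x <- r].
have sP a : a \in s -> a != 0 /\ exists x y, a = row3 x y 0.
  rewrite mem_cat => /orP[/nseqP[-> _]|/mapP[x _ ->]].
    split; last by exists 0, 1.
    by apply/rV0Pn; exists 1; rewrite mxE /= oner_neq0.
  split; last by exists 1, (- x).
  by apply/rV0Pn; exists 0; rewrite mxE /= oner_neq0.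
have hs : \prod_(a <- s) linform a \is (size s).-homog.
  elim: s {sP} => [|a s' IH]; first by rewrite big_nil dhomog1.
  by rewrite big_cons; apply: (dhomogM (d := 1)) => //; apply: linform_homog.
exists s, (lead_coef B), P, (N0 + (e + size r))%N; split=> //.
- by apply/allP => a /sP[].
- by move=> a /sP[].
- by rewrite lead_coef_eq0.
split=> //; apply/eqP; rewrite -subr_eq0; apply/eqP.
apply: (@deh_inj _ (N0 + (e + size r) + E)); last first.
  rewrite dehB !dehM dehZ eP -eB deh_prod big_cat /= big_nseq.
  rewrite deh_row3 scale0r add0r polyC0 scale0r addr0.
  rewrite (_ : iter _ _ _ = 1); last by elim: (t) => //= k ->; rewrite mulr1.
  rewrite mul1r big_map (eq_bigr (fun x => ('X - x%:P)%:P)); last first.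
    by move=> x _; rewrite deh_row3 scale1r scale0r addr0 polyCN.
  rewrite -(rmorph_prod (@polyC _)) /= -!mul_polyC mulrA -polyCM.
  by rewrite [X in X%:P * _ - _](_ : _ = B) ?subrr // [RHS]rE -mul_polyC mulrC.
apply: rpredB; last exact: dhomogM.
have -> : (N0 + (e + size r) + E = size s + e)%N.
  by rewrite /s size_cat size_nseq size_map /t; ring.
by apply: dhomogM => //; apply: dhomogZ.
Qed.

End Dehomogenize.
(** In the factorization [mulmx_ebase] of a nonzero column, [row_ebase] is a nonzero scalar and the
    rest is an invertible matrix applied to the first basis vector. *)
Lemma unitmx_transitive (K : fieldType) n (u v : 'cV[K]_n) : u != 0 -> v != 0 ->
  exists2 A : 'M[K]_n, A \in unitmx & A *m u = v.
Proof.
have rank1 (w : 'cV[K]_n) : w != 0 -> \rank w = 1%N.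
  by move=> w0; rewrite -mxrank_tr rank_rV -trmx0 (inj_eq trmx_inj) w0.
move=> /rank1 ru /rank1 rv.
have [a [a0 eu]] : exists a : K, a != 0 /\ u = a *: (col_ebase u *m pid_mx 1).
  have e := mulmx_ebase u; have ur := row_ebase_unit u.
  rewrite [row_ebase u]mx11_scalar in e ur; rewrite mul_mx_scalar ru in e.
  by move: ur; rewrite unitmxE det_scalar1 unitfE; exists (row_ebase u 0 0).
have [b [b0 ev]] : exists b : K, b != 0 /\ v = b *: (col_ebase v *m pid_mx 1).
  have e := mulmx_ebase v; have ur := row_ebase_unit v.
  rewrite [row_ebase v]mx11_scalar in e ur; rewrite mul_mx_scalar rv in e.
  by move: ur; rewrite unitmxE det_scalar1 unitfE; exists (row_ebase v 0 0).
exists ((b / a) *: (col_ebase v *m invmx (col_ebase u))).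
  rewrite unitmxZ ?unitfE ?mulf_neq0 ?invr_eq0 // unitmx_mul.
  by rewrite unitmx_inv !col_ebase_unit.
rewrite {2}eu -scalemxAl -scalemxAr scalerA divfK // mulmxA mulmxKV ?col_ebase_unit //.
Qed.

(** * Irreducible forms and finiteness of common zeros *)

Section Irreducible.
Context (K : numClosedFieldType).
Implicit Types (F G P Q f h : {mpoly K[3]}) (v : 'cV[K]_3) (a : 'rV[K]_3).

(** Only [g] is required to be a form: by [dhomog_div] its cofactor is then one as well. *)
Definition irreducible_form m f := [/\ (0 < m)%N, f \is m.-homog, f != 0 &
  forall d g q, (0 < d < m)%N -> g \is d.-homog -> f <> q * g].

Lemma irreducible_form_comp m f A : A \in unitmx -> irreducible_form m f ->
  irreducible_form m (mcomp A f).
Proof.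
move=> uA [m0 hf f0 irr]; split=> //; [exact: mcomp_homog|by rewrite mcomp_eq0|].
move=> d g q dm hg e; apply: (irr d (mcomp (invmx A) g) (mcomp (invmx A) q)) => //.
  exact: mcomp_homog.
by rewrite -mcompM -e mcompK.
Qed.

Lemma dhomog_neq0_const F : F \is 0.-homog -> F != 0 -> exists2 c, c != 0 & F = c%:MP.
Proof.
move=> /dhomog0_const e F0; exists (F@_0%MM) => //.
by apply: contraNneq F0 => c0; rewrite e c0 mpolyC0.
Qed.

Lemma deh_linforms_const (s : seq 'rV[K]_3) :
  (forall a, a \in s -> exists x y, a = row3 x y 0) ->
  exists b : {poly K}, deh (\prod_(a <- s) linform a) = b%:P.
Proof.
elim: s => [|a s IH] sP; first by exists 1; rewrite big_nil -mpolyC1 dehC.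
have [b eb] : exists b : {poly K}, deh (\prod_(a <- s) linform a) = b%:P.
  by apply: IH => a' a's; apply: sP; rewrite inE a's orbT.
have [x [y ->]] := sP a (mem_head _ _).
exists ((x *: 'X + y%:P) * b); rewrite big_cons dehM eb deh_row3.
by rewrite scale0r addr0 polyCM.
Qed.

Lemma linforms_homog n (s : seq 'rV[K]_n) :
  \prod_(a <- s) linform a \is (size s).-homog.
Proof.
elim: s => [|a s' IH]; first by rewrite big_nil dhomog1.
by rewrite big_cons; apply: (dhomogM (d := 1)) => //; apply: linform_homog.
Qed.

(* Gauss' lemma: in the chart y = 1 the form f stays irreducible over K(x). *)
Lemma irreducible_deh m f (B : {poly K}) (p g : {poly {poly K}}) :
  irreducible_form m f -> B != 0 -> B *: deh f = p * g -> (1 < size g)%N ->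
  (size p <= 1)%N.
Proof.
move=> [m0 hf f0 irr] B0 eB g1.
have [N /(_ N (leqnn N)) [G hG eG]] := homogenizeP g.
rewrite -eG in eB.
have [s [c [P [D [s0 s3 c0 hP [eP e]]]]]] := homog_relation B0 hf hG eB.
have [s1 [s2 [P' [G' [s1s s2s e1 e2 ef]]]]] := strip_linforms s0 e.
have cf0 : c *: f != 0 by rewrite scaler_eq0 negb_or c0.
have [P'0 G'0] : P' != 0 /\ G' != 0.
  by apply/andP; rewrite ef mulf_eq0 negb_or in cf0.
have [b2 eb2] : exists b : {poly K}, deh (\prod_(a <- s2) linform a) = b%:P.
  by apply: deh_linforms_const => a /s2s /s3.
have [b1 eb1] : exists b : {poly K}, deh (\prod_(a <- s1) linform a) = b%:P.
  by apply: deh_linforms_const => a /s1s /s3.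
have l0 (s' : seq 'rV[K]_3) : {subset s' <= s} -> \prod_(a <- s') linform a != 0.
  move=> ss; rewrite prodf_seq_neq0; apply/allP => a /ss as_ /=.
  by rewrite linform_eq0 (allP s0).
have [_ hG'] : (size s2 <= N)%N /\ G' \is (N - size s2).-homog.
  apply: dhomog_div (linforms_homog s2) _ _; rewrite -e2 //.
  by rewrite e2 mulf_neq0 ?l0.
have [Nm hP'] : (N - size s2 <= m)%N /\ P' \is (m - (N - size s2)).-homog.
  by apply: dhomog_div hG' _ _; rewrite mulrC -ef //; apply: dhomogZ.
(* Degree 0 for [G'] would make [g] constant in z, an intermediate degree contradicts
   irreducibility, and degree [m] leaves [P'] constant. *)
have [d0|d0] := posnP (N - size s2).
  have [|k k0 eG'] := @dhomog_neq0_const G' _ G'0; first by move: hG'; rewrite d0.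
  move: g1; rewrite -eG e2 dehM eb2 eG' dehC -polyCM.
  by rewrite ltnNge size_polyC_leq1.
have [dm|dm] := ltnP (N - size s2) m.
  have [] := irr (N - size s2)%N G' (c^-1 *: P'); rewrite ?d0 //.
  by rewrite -scalerAl -ef scalerA mulVf ?scale1r.
have [|k k0 eP'] := @dhomog_neq0_const P' _ P'0.
  by move: hP'; rewrite (eqP (_ : (m - _ == 0)%N)) // subn_eq0.
by rewrite -eP e1 dehM eb1 eP' dehC -polyCM size_polyC_leq1.
Qed.

(* The form f is a polynomial of degree m in z with constant leading
   coefficient, so none of the linear forms in x, y can divide it. *)
Lemma dvd_of_deh f m h e p (B : {poly K}) : (0 < m)%N -> f \is m.-homog ->
  mev f (vec3 0 0 1) != 0 -> h \is e.-homog -> B != 0 ->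
  B *: deh h = p * deh f -> mdvd f h.
Proof.
move=> m0 hf fe hh B0 eB.
have [s [c [P [D [s0 s3 c0 hP [eP es]]]]]] := homog_relation B0 hh hf eB.
have [s1 [s2 [P' [f' [s1s s2s e1 e2 eh]]]]] := strip_linforms s0 es.
case: s2 s2s e2 => [_|a s2 s2s] e2.
  exists (c^-1 *: P'); rewrite e2 big_nil mul1r -scalerAl -eh scalerA mulVf //.
  by rewrite scale1r.
case/eqP: fe; rewrite e2 big_cons !mevM mev_linform.
have [|x [y ->]] := s3 a; first by apply: s2s; rewrite mem_head.
by rewrite !mxE !(big_ord_recl, big_ord0) !mxE /= !(mulr0, mul0r, addr0).
Qed.

(** If the gcd in z is nonconstant, [irreducible_deh] makes it equal to [deh f] up to factors in
    K[x], so [deh f] divides [deh h] over K(x). Otherwise clearing denominators in the Bezout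
    relation leaves [c] in K[x]. *)
Lemma dvd_or_bezout m f h e : irreducible_form m f -> mev f (vec3 0 0 1) != 0 ->
  h \is e.-homog -> mdvd f h \/ exists p q (c : {poly K}),
    c != 0 /\ p * deh f + q * deh h = c%:P.
Proof.
move=> irr fe hh; have [m0 hf f0 _] := irr.
have [/Pdiv.Idomain.Bezout_coprimepP[[u v]] /=|] := boolP (Pdiv.Idomain.coprimep (deh f) (deh h)).
  rewrite -size_poly_eq1 => /eqP /eqP /size_poly1P[c c0 e1].
  by right; exists u, v, c.
rewrite Pdiv.Idomain.coprimep_def => g1; left.
set g := gcdp _ _ in g1.
have df0 : deh f != 0 by rewrite -size_poly_eq0 (deh_size hf fe).
have g0 : g != 0 by rewrite gcdp_eq0 negb_and df0.
have {}g1 : (1 < size g)%N by rewrite ltn_neqAle eq_sym g1 size_poly_gt0.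
have /Pdiv.Idomain.dvdpP[[B p] /= B0 ef] : g %| deh f := Pdiv.Idomain.dvdp_gcdl _ _.
have /Pdiv.Idomain.dvdpP[[C q] /= C0 eh] : g %| deh h := Pdiv.Idomain.dvdp_gcdr _ _.
have /size1_polyC ep := irreducible_deh irr B0 ef g1.
set b := p`_0 in ep; have b0 : b != 0.
  apply: contraNneq df0 => b0; have : (B : {poly K})%:P * deh f == 0.
    by rewrite mul_polyC ef ep b0 mul0r.
  by rewrite mulf_eq0 polyC_eq0 (negPf B0).
apply: (@dvd_of_deh f m h e (B *: q) (b * C)) => //; first by rewrite mulf_neq0.
rewrite -!mul_polyC in ef eh *; rewrite polyCM -mulrA eh.
by rewrite mulrAC ef ep mulrAC mulrA mulrAC.
Qed.

(** A common zero (x, 1, z) has x among the roots of [c]. As [f] is nonzero at (0, 0, 1), its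
    restriction to each line through that point is a nonzero polynomial in z, so each such x, and
    likewise the line y = 0, carries finitely many zeros. *)
Lemma irreducible_common_zeros0 m f h e : irreducible_form m f ->
  mev f (vec3 0 0 1) != 0 -> h \is e.-homog -> ~ mdvd f h ->
  proj_finite (fun v => [/\ v != 0, mev f v = 0 & mev h v = 0]).
Proof.
move=> irr fe hh ndvd; have [m0 hf f0 _] := irr.
have [//|[u [w [c [c0 ec]]]]] := dvd_or_bezout irr fe hh.
have [r rE] := closed_field_poly_normal c.
have rts (a b : K) : exists s : seq K, forall z, mev f (vec3 a b z) = 0 -> z \in s.
  have sz := lres_size (vec3 a b 0) hf fe.
  have [s sE] := closed_field_poly_normal (lres f (vec3 a b 0) (vec3 0 0 1)).
  have l0 : lead_coef (lres f (vec3 a b 0) (vec3 0 0 1)) != 0.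
    by rewrite lead_coef_eq0 -size_poly_eq0 sz.
  exists s => z fz; rewrite -root_prod_XsubC -(rootZ _ _ l0) -sE.
  apply/rootP; rewrite horner_lres -[RHS]fz; congr (mev f _).
  by apply/colP => -[[|[|[|//]]]] ?; rewrite !mxE /= ?mulr0 ?mulr1 ?addr0 ?add0r.
have [S SE] := choice (fun x : K => rts x 1); have [T TE] := rts 1 0.
exists ([seq vec3 1 0 z | z <- T] ++ flatten [seq [seq vec3 x 1 z | z <- S x] | x <- r]).
move=> v [v0 fv hv].
have fZ k (k0 : k != 0) : mev f (k *: v) = 0 by rewrite (mev_homogZ _ _ hf) fv mulr0.
have hZ k (k0 : k != 0) : mev h (k *: v) = 0 by rewrite (mev_homogZ _ _ hh) hv mulr0.
have [v1|v1] := eqVneq (v 1 0) 0.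
  have v00 : v 0 0 != 0.
    apply: contraNneq fe => v00; have v2 : v 2%:R 0 != 0.
      apply: contraNneq v0 => v2; rewrite [v]vec3P v1 v2 v00.
      by apply/eqP/colP => -[[|[|[|//]]]] ?; rewrite !mxE.
    have -> : vec3 0 0 1 = (v 2%:R 0)^-1 *: v.
      rewrite {2}[v]vec3P v00 v1; apply/colP => -[[|[|[|//]]]] ?; rewrite !mxE /= ?mulr0 //.
      by rewrite mulVf.
    by rewrite fZ ?invr_eq0.
  exists (v 0 0) => //; exists (vec3 1 0 (v 2%:R 0 / v 0 0)).
    rewrite mem_cat map_f //; apply: TE.
    have <- : (v 0 0)^-1 *: v = vec3 1 0 (v 2%:R 0 / v 0 0).
      rewrite {2}[v]vec3P v1.
      by apply/colP => -[[|[|[|//]]]] ?; rewrite !mxE /= ?mulr0 ?mulVf // mulrC.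
    by rewrite fZ ?invr_eq0.
  rewrite {1}[v]vec3P v1; apply/colP => -[[|[|[|//]]]] ?; rewrite !mxE /= ?mulr0 ?mulr1 //.
  by rewrite mulrC divfK.
have ev : (v 1 0)^-1 *: v = vec3 (v 0 0 / v 1 0) 1 (v 2%:R 0 / v 1 0).
  rewrite {2}[v]vec3P.
  by apply/colP => -[[|[|[|//]]]] ?; rewrite !mxE /= ?mulVf // mulrC.
exists (v 1 0) => //; exists ((v 1 0)^-1 *: v); last by rewrite scalerA mulfV ?scale1r.
rewrite ev mem_cat; apply/orP; right; apply/flattenP.
exists [seq vec3 (v 0 0 / v 1 0) 1 z | z <- S (v 0 0 / v 1 0)]; last first.
  by apply: map_f; apply: SE; rewrite -ev fZ ?invr_eq0.
apply/mapP; exists (v 0 0 / v 1 0) => //.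
have l0 : lead_coef c != 0 by rewrite lead_coef_eq0.
rewrite -root_prod_XsubC -(rootZ _ _ l0) -rE; apply/rootP.
have := congr1 (fun q => q.[(v 2%:R 0 / v 1 0)%:P].[v 0 0 / v 1 0]) ec.
by rewrite !hornerE !horner_deh -ev fZ ?invr_eq0 // hZ ?invr_eq0 // !mulr0 addr0.
Qed.

Lemma irreducible_common_zeros m f h e : irreducible_form m f -> h \is e.-homog ->
  ~ mdvd f h -> proj_finite (fun v => [/\ v != 0, mev f v = 0 & mev h v = 0]).
Proof.
move=> irr hh ndvd; have [m0 hf f0 _] := irr.
have [v0 fv0] := mpoly_neq0_mev f0.
have [||A uA Ae] := @unitmx_transitive K 3 (vec3 0 0 1) v0.
- by apply/cV0Pn; exists 2%:R; rewrite mxE oner_neq0.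
- by apply: contraNneq fv0 => ->; rewrite (mev_homog0 m0 hf).
have [||s sP] := irreducible_common_zeros0 (irreducible_form_comp uA irr) _ (mcomp_homog A hh).
- by rewrite mev_comp Ae.
- case=> Q eQ; apply: ndvd; exists (mcomp (invmx A) Q).
  by apply: (can_inj (mcompK uA)); rewrite eQ mcompM mcompVK.
exists [seq A *m u | u <- s] => v [v0' fv hv].
have [|c c0 [u us eu]] := sP (invmx A *m v).
  split; rewrite ?mev_comp ?mulmxA ?mulmxV // ?mul1mx //.
  by apply: contraNneq v0' => e0; rewrite -[v](mulKVmx uA) e0 mulmx0.
exists c => //; exists (A *m u); first exact: map_f.
by rewrite scalemxAr -eu mulKVmx.
Qed.

End Irreducible.

(** * Resultants and existence of common zeros *)

Section ResultantScaling.
Context (K : numClosedFieldType).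
Implicit Types (p q : {poly K}).

(** Fixes the dimension as [e + m], so that the Sylvester matrices of two pairs have the same
    type. *)
Lemma resultantE p q m e : size p = m.+1 -> size q = e.+1 ->
  resultant p q = \det (\matrix_(i < e + m, j < e + m)
    match fintype.split i with
    | inl k => p`_(j - k) *+ (k <= j)
    | inr k => q`_(j - k) *+ (k <= j)
    end).
Proof.
move=> sp sq; rewrite /resultant.
have -> : Sylvester_mx p q = \matrix_(i < (size q).-1 + (size p).-1, j < (size q).-1 + (size p).-1)
    match fintype.split i with
    | inl k => p`_(j - k) *+ (k <= j)
    | inr k => q`_(j - k) *+ (k <= j)
    end by apply/matrixP => i j; rewrite Sylvester_mxE mxE.
by rewrite sp sq.
Qed.

(** The hypotheses say p'(t) = s^m p(t/s) and q'(t) = s^e q(t/s). Diagonal matrices of powers of [s]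
    intertwine the two Sylvester matrices, and [m * e] is the difference of their total
    exponents. *)
Lemma resultant_scale (s : K) p q p' q' m e : s != 0 ->
  size p = m.+1 -> size p' = m.+1 -> size q = e.+1 -> size q' = e.+1 ->
  (forall i, p'`_i * s ^+ i = s ^+ m * p`_i) ->
  (forall i, q'`_i * s ^+ i = s ^+ e * q`_i) ->
  resultant p' q' = s ^+ (m * e) * resultant p q.
Proof.
move=> s0 sp sp' sq sq' ep eq; rewrite (resultantE sp sq) (resultantE sp' sq').
set A' := \matrix_(i, j) _; set A := \matrix_(i, j) _.
pose D : 'rV[K]_(e + m) := \row_j s ^+ j.
pose D' : 'rV[K]_(e + m) := \row_i match fintype.split i with
  | inl k => s ^+ (m + k) | inr k => s ^+ (e + k) end.
have eA : A' *m diag_mx D = diag_mx D' *m A.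
  apply/matrixP => i j; rewrite mul_mx_diag mul_diag_mx !mxE.
  by case: fintype.split => k; (case: leqP => kj; last by rewrite !mulr0n mul0r mulr0);
    rewrite !mulr1n -{2}(subnK kj) exprD mulrA (ep, eq) exprD; ring.
have := congr1 determinant eA; rewrite !det_mulmx !det_diag.
rewrite [X in _ * X = _](_ : _ = \prod_(k < e) s ^+ k * \prod_(k < m) s ^+ (e + k)).
  rewrite [X in _ = X * _](_ : _ = s ^+ (m * e) * \prod_(k < e) s ^+ k *
      \prod_(k < m) s ^+ (e + k)).
    set P := \prod_(k < e) _; set P' := \prod_(k < m) _ => eqn.
    have PP0 : P * P' != 0.
      by rewrite mulf_neq0 //; apply/prodf_neq0 => k _; rewrite expf_neq0.
    by apply: (mulIf PP0); rewrite eqn; ring.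
  rewrite big_split_ord /=; congr (_ * _); last first.
    by apply: eq_bigr => k _; rewrite mxE -/(unsplit (inr k)) unsplitK.
  rewrite exprM -[s ^+ m ^+ e](_ : \prod_(k < e) s ^+ m = _); last first.
    by rewrite prodr_const card_ord.
  rewrite -big_split; apply: eq_bigr => k _.
  by rewrite mxE -/(unsplit (inl k)) unsplitK exprD.
rewrite big_split_ord; congr (_ * _); apply: eq_bigr => k _; by rewrite mxE.
Qed.

Lemma resultant_common_root p q : resultant p q = 0 -> exists z, p.[z] = 0 /\ q.[z] = 0.
Proof.
move/eqP; rewrite resultant_eq0 => g1.
have /closed_rootP[z] : size (gcdp p q) != 1 by rewrite neq_ltn g1 orbT.
by rewrite root_gcd => /andP[/rootP pz /rootP qz]; exists z.
Qed.

End ResultantScaling.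

Section WeakBezout.
Context (K : numClosedFieldType).
Implicit Types (F f h : {mpoly K[3]}) (u v w : 'cV[K]_3).

(** Compare coefficients of t in F(s u + s t w) = s^d F(u + t w). *)
Lemma lres_scale d F u w s i : F \is d.-homog ->
  (lres F (s *: u) w)`_i * s ^+ i = s ^+ d * (lres F u w)`_i.
Proof.
move=> hF; pose p := lres F (s *: u) w.
have : \poly_(j < size p) (p`_j * s ^+ j) = s ^+ d *: lres F u w.
  apply/eqP; rewrite -subr_eq0; apply/eqP/poly_eq0_horner => t.
  rewrite hornerD hornerN hornerZ horner_lres -(mev_homogZ _ _ hF) scalerDr scalerA.
  rewrite -horner_lres -/p horner_poly [p.[_]]horner_coef; apply/eqP.
  rewrite subr_eq0; apply/eqP/eq_bigr => j _; rewrite exprMn; ring.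
move=> /(congr1 (fun q : {poly K} => q`_i)); rewrite coefZ coef_poly => <-.
by case: ltnP => // pi; rewrite nth_default ?mul0r.
Qed.

Local Notation e3 := (vec3 0 0 1 : 'cV[K]_3).
Local Notation res f h u := (resultant (lres f u e3) (lres h u e3)).

Lemma horner_resultant_deh f h m e x : f \is m.-homog -> h \is e.-homog ->
  mev f e3 != 0 -> mev h e3 != 0 ->
  (resultant (deh f) (deh h)).[x] = res f h (vec3 x 1 0).
Proof.
have lc F d : F \is d.-homog -> mev F e3 != 0 ->
    (lead_coef (deh F)).[x] != 0.
  move=> hF Fe; rewrite lead_coefE (deh_size hF Fe) /=.
  by have [_ ->] := deh_top hF; rewrite hornerC.
move=> hf hh fe he; rewrite -!map_deh -map_resultant //; [exact: lc hf fe|exact: lc hh he].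
Qed.

Lemma res_common_zero f h u : res f h u = 0 ->
  (exists i, i != 2%:R /\ u i 0 != 0) ->
  exists2 v, v != 0 & mev f v = 0 /\ mev h v = 0.
Proof.
move=> /resultant_common_root[z]; rewrite !horner_lres => fh [i [i2 ui]].
exists (u + z *: e3) => //; apply/cV0Pn; exists i; rewrite !mxE.
by case: i i2 ui => -[|[|[|//]]] ? //= _; rewrite mulr0 addr0.
Qed.

(** The resultant in z is a form of degree [m * e > 0] in x and y, and [r1], [r2] are its
    restrictions to y = 1 and x = 1; the swap [A] brings the second back to the first. If [r1] has
    no root, it is a nonzero constant, and then [r2] is a multiple of ['X^(m * e)], with root 0. *)
Lemma common_zero0 f h m e : (0 < m)%N -> (0 < e)%N ->
  f \is m.-homog -> h \is e.-homog -> mev f e3 != 0 -> mev h e3 != 0 ->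
  exists2 v, v != 0 & mev f v = 0 /\ mev h v = 0.
Proof.
move=> m0 e0 hf hh fe he.
pose A : 'M[K]_3 := \matrix_(i, j)
  (nth [::] [:: [:: 0; 1; 0]; [:: 1; 0; 0]; [:: 0; 0; 1]] i)`_j.
have Av x y z : A *m vec3 x y z = vec3 y x z.
  by apply/colP => -[[|[|[|//]]]] ?; rewrite !mxE !(big_ord_recl, big_ord0) !mxE /=; ring.
have resA x y : res (mcomp A f) (mcomp A h) (vec3 x y 0) = res f h (vec3 y x 0).
  congr (resultant _ _); apply/eqP; rewrite -subr_eq0; apply/eqP/poly_eq0_horner => t;
  by rewrite hornerD hornerN !horner_lres mev_comp mulmxDr -scalemxAr !Av subrr.
pose r1 := resultant (deh f) (deh h).
pose r2 := resultant (deh (mcomp A f)) (deh (mcomp A h)).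
have er1 x : r1.[x] = res f h (vec3 x 1 0) by apply: horner_resultant_deh hf hh fe he.
have er2 x : r2.[x] = res f h (vec3 1 x 0).
  rewrite -resA; apply: horner_resultant_deh (mcomp_homog A hf) (mcomp_homog A hh) _ _;
  by rewrite mev_comp Av.
have [/size_poly1P[c c0 r1c]|/closed_rootP[x /rootP]] := boolP (size r1 == 1); last first.
  rewrite er1 => /res_common_zero; apply.
  by exists 1; rewrite mxE /= oner_neq0.
(* Scaling compares the two charts only off 0; the factor ['X] takes care of the remaining point. *)
have r2E : 'X * (r2 - c *: 'X^(m * e)) = 0.
  apply: poly_eq0_horner => y; rewrite hornerM hornerX.
  have [->|y0] := eqVneq y 0; first by rewrite mul0r.
  rewrite hornerD hornerN hornerZ hornerXn er2.
  have -> : vec3 1 y 0 = y *: vec3 y^-1 1 0.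
    by apply/colP => -[[|[|[|//]]]] ?; rewrite !mxE /= ?mulfV ?mulr1 ?mulr0.
  rewrite (@resultant_scale K y (lres f (vec3 y^-1 1 0) e3) (lres h (vec3 y^-1 1 0) e3) _ _ m e)
    ?(lres_size _ hf) ?(lres_size _ hh) //; try by move=> i; apply: lres_scale.
  by rewrite -er1 r1c hornerC [c * _]mulrC subrr mulr0.
have : r2.[0] = 0.
  move/eqP: r2E; rewrite mulf_eq0 polyX_eq0 /= subr_eq0 => /eqP ->.
  by rewrite hornerZ hornerXn expr0n muln_eq0 !gtn_eqF // mulr0.
rewrite er2 => /res_common_zero; apply.
by exists 0; rewrite mxE /= oner_neq0.
Qed.

Lemma forms_common_zero f h m e : (0 < m)%N -> (0 < e)%N ->
  f \is m.-homog -> h \is e.-homog -> f != 0 -> h != 0 ->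
  exists2 v, v != 0 & mev f v = 0 /\ mev h v = 0.
Proof.
move=> m0 e0 hf hh f0 h0.
have [v0] : exists v, mev (f * h) v != 0 by apply: mpoly_neq0_mev; rewrite mulf_neq0.
rewrite mevM mulf_eq0 negb_or => /andP[fv hv].
have [||A uA Ae] := @unitmx_transitive K 3 e3 v0.
- by apply/cV0Pn; exists 2%:R; rewrite mxE oner_neq0.
- by apply: contraNneq fv => ->; rewrite (mev_homog0 m0 hf).
have [||v vn0] := common_zero0 m0 e0 (mcomp_homog A hf) (mcomp_homog A hh).
- by rewrite mev_comp Ae.
- by rewrite mev_comp Ae.
rewrite !mev_comp => fh; exists (A *m v) => //.
by apply: contraNneq vn0 => e1; rewrite -[v](mulKmx uA) e1 mulmx0.
Qed.

End WeakBezout.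
(** * Polars and Hessians *)

Section Hessian.
Context (K : numClosedFieldType).
Implicit Types (F G f h : {mpoly K[3]}) (u v w p : 'cV[K]_3).

Lemma mderiv_homog n d (F : {mpoly K[n]}) i : F \is d.-homog -> F^`M(i) \is d.-1.-homog.
Proof.
move=> /dhomogP hF; apply/dhomogP => m; rewrite mcoeff_msupp mcoeff_mderiv => mF.
have /hF /= : (m + U_(i))%MM \in msupp F.
  by rewrite mcoeff_msupp; apply: contraNneq mF => ->; rewrite mul0rn.
by rewrite mdegD mdeg1 addn1 => <-.
Qed.

Lemma euler_homog n d (F : {mpoly K[n]}) : F \is d.-homog ->
  \sum_i 'X_i * F^`M(i) = F *+ d.
Proof.
move=> /dhomogP hF; rewrite [in RHS](mpolyE F) -sumrMnl.
rewrite [in LHS](eq_bigr (fun i => \sum_(m <- msupp F) F@_m *: ('X_i * 'X_[m]^`M(i)))); last first.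
  move=> i _; rewrite {1}(mpolyE F) raddf_sum mulr_sumr; apply: eq_bigr => m _.
  by rewrite /= mderivZ -scalerAr.
rewrite exchange_big /= !big_seq; apply: eq_bigr => m mF.
rewrite -(hF _ mF) /= mdegE -scaler_sumr scalerMnr; congr (_ *: _).
rewrite -sumrMnr; apply: eq_bigr => i _.
rewrite mderivX -scalerAr -mpolyXD; have [->|mi] := posnP (m i).
  by rewrite scale0r mulr0n.
rewrite scaler_nat addmC submK //; apply/mnm_lepP => j.
by rewrite mnm1E; case: eqP => // <-.
Qed.

Lemma det_mx33 (S : comNzRingType) (A : 'M[S]_3) :
  \det A = A 0 0 * (A 1 1 * A 2%:R 2%:R - A 1 2%:R * A 2%:R 1)
         - A 0 1 * (A 1 0 * A 2%:R 2%:R - A 1 2%:R * A 2%:R 0)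
         + A 0 2%:R * (A 1 0 * A 2%:R 1 - A 1 1 * A 2%:R 0).
Proof.
rewrite (expand_det_row _ 0) !(big_ord_recl, big_ord0) /cofactor.
rewrite !(expand_det_row _ 0) !(big_ord_recl, big_ord0) /cofactor !det_mx11 !mxE /=.
have l0 : lift 0 0 = 1 :> 'I_3 by apply: val_inj.
have l1 : lift 0 1 = 2%:R :> 'I_3 by apply: val_inj.
have l2 : lift 1 0 = 0 :> 'I_3 by apply: val_inj.
have l3 : lift 1 1 = 2%:R :> 'I_3 by apply: val_inj.
have l4 : lift 2%:R 0 = 0 :> 'I_3 by apply: val_inj.
have l5 : lift 2%:R 1 = 1 :> 'I_3 by apply: val_inj.
have k0 : lift 0 0 = 1 :> 'I_2 by apply: val_inj.
have k1 : lift 1 0 = 0 :> 'I_2 by apply: val_inj.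
rewrite !(l0, l1, l2, l3, l4, l5, k0, k1) /=; ring.
Qed.

Definition polar (f : {mpoly K[3]}) p : {mpoly K[3]} := \sum_i p i 0 *: f^`M(i).

Lemma polar_homog d f p : f \is d.-homog -> polar f p \is d.-1.-homog.
Proof.
by move=> hf; apply: rpred_sum => i _; apply: dhomogZ; apply: mderiv_homog.
Qed.

Lemma deriv_lres f p w : (lres f p w)^`() = lres (polar f w) p w.
Proof.
rewrite deriv_mmap /lres /polar raddf_sum; apply: eq_bigr => i _ /=.
rewrite mmapZ derivD derivC derivZ derivX add0r mulrC; congr (_ * _).
by rewrite alg_polyC.
Qed.

Lemma polar_comp A f v w : mev (polar (mcomp A f) w) v = mev (polar f (A *m w)) (A *m v).
Proof.
have := congr1 (fun q => q^`().[0]) (_ : lres (mcomp A f) v w = lres f (A *m v) (A *m w)).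
rewrite !deriv_lres !horner_lres !scale0r !addr0; apply.
apply/eqP; rewrite -subr_eq0; apply/eqP/poly_eq0_horner => t.
by rewrite hornerD hornerN !horner_lres mev_comp mulmxDr -scalemxAr subrr.
Qed.

Definition hess_mx f : 'M[{mpoly K[3]}]_3 := \matrix_(i, j) f^`M(i)^`M(j).
Definition hess f : {mpoly K[3]} := \det (hess_mx f).

(** For a quadratic form this matrix is constant, and [hmx f 0] below stands for its Gram matrix (up
    to the factor 2). *)
Definition hmx f v : 'M[K]_3 := \matrix_(i, j) mev f^`M(i)^`M(j) v.

Lemma mev_hess f v : mev (hess f) v = \det (hmx f v).
Proof.
rewrite /mev /hess -det_map_mx; congr (\det _); apply/matrixP => i j.
by rewrite !mxE.
Qed.

Lemma hess_homog m f : f \is m.-homog -> hess f \is (3 * m.-2).-homog.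
Proof.
move=> hf; rewrite /hess det_mx33 !mxE !mulSn mul0n addn0.
have h2 i j : f^`M(i)^`M(j) \is m.-2.-homog by do 2 apply: mderiv_homog.
have h4 i j k l : f^`M(i)^`M(j) * f^`M(k)^`M(l) \is (m.-2 + m.-2).-homog.
  exact: dhomogM.
by apply: rpredD; [apply: rpredB|]; apply: dhomogM => //; apply: rpredB.
Qed.

Lemma mev_mderiv_comp A f i v :
  mev (mcomp A f)^`M(i) v = \sum_k A k i * mev f^`M(k) (A *m v).
Proof.
have := polar_comp A f v (delta_mx i 0); rewrite /polar 2!mev_sum (bigD1 i) //=.
rewrite big1 => [|j ji]; last by rewrite mevZ !mxE (negPf ji) mul0r.
rewrite addr0 mevZ !mxE !eqxx mul1r => ->; apply: eq_bigr => k _.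
rewrite mevZ -colE mxE; congr (_ * _).
Qed.

Lemma hmx_comp A f v : hmx (mcomp A f) v = A^T *m hmx f (A *m v) *m A.
Proof.
apply/matrixP => i j; rewrite mxE.
have -> : (mcomp A f)^`M(i) = \sum_k A k i *: mcomp A f^`M(k).
  apply: mpoly_mevP => u; rewrite mev_mderiv_comp mev_sum.
  by apply: eq_bigr => k _; rewrite mevZ mev_comp.
rewrite raddf_sum mev_sum /= !mxE.
under eq_bigr => k _ do rewrite mderivZ mevZ mev_mderiv_comp mulr_sumr.
rewrite exchange_big; apply: eq_bigr => k _ /=; rewrite !mxE mulr_suml.
by apply: eq_bigr => l _; rewrite !mxE; ring.
Qed.

Lemma hmxB f h v : hmx (f - h) v = hmx f v - hmx h v.
Proof. by apply/matrixP => i j; rewrite !mxE !mderivB mevB. Qed.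

Lemma hmxZ c f v : hmx (c *: f) v = c *: hmx f v.
Proof. by apply/matrixP => i j; rewrite !mxE !mderivZ mevZ. Qed.

Lemma hmx_sym f v : (hmx f v)^T = hmx f v.
Proof. by apply/matrixP => i j; rewrite !mxE mderiv_comm. Qed.

Lemma lres_hess f p w : lres (hess f) p w = \det (\matrix_(i, j) lres f^`M(i)^`M(j) p w).
Proof.
rewrite /lres /hess -det_map_mx; congr (\det _).
by apply/matrixP => i j; rewrite !mxE.
Qed.

End Hessian.

(** * Smooth points, cones and the order of the Hessian along a tangent *)

Section Flexes.
Context (K : numClosedFieldType).
Implicit Types (F G f h : {mpoly K[3]}) (u v w p : 'cV[K]_3).

Lemma irreducible_linform m f a : irreducible_form m f -> (1 < m)%N -> a != 0 ->
  ~ mdvd (linform a) f.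
Proof.
move=> [m0 hf f0 irr] m1 a0 [Q eQ].
by apply: (irr 1%N (linform a) Q) => //; apply: linform_homog.
Qed.

(** Some line misses the finitely many points of [s], and the curve meets every line. *)
Lemma form_zero_avoiding m f (s : seq 'cV[K]_3) : (0 < m)%N -> f \is m.-homog ->
  f != 0 -> exists v, [/\ v != 0, mev f v = 0 &
    forall u c, u \in s -> c != 0 -> v <> c *: u].
Proof.
(* The extra point keeps the list nonempty, which forces the line [a^T] to be nonzero. *)
move=> m0 hf f0; pose s' := vec3 0 0 1 :: [seq u <- s | u != 0].
have s'0 u : u \in s' -> u != 0.
  rewrite inE mem_filter => /orP[/eqP->|/andP[//]].
  by apply/cV0Pn; exists 2%:R; rewrite mxE oner_neq0.
have [a] : exists a, mev (\prod_(u <- s') linform u^T) a != 0.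
  apply: mpoly_neq0_mev; rewrite prodf_seq_neq0; apply/allP => u /s'0 /= u0.
  by rewrite linform_eq0 -trmx0 (inj_eq trmx_inj).
rewrite mev_prod prodf_seq_neq0 => /allP a_s.
have bu u : u \in s' -> a^T *m u != 0.
  move=> /a_s /=; rewrite mev_linform; apply: contraNneq => e.
  by rewrite -[u^T *m a]trmxK trmx_mul trmxK e !mxE.
have b0 : a^T != 0 by apply: contraNneq (bu _ (mem_head _ _)) => ->; rewrite mul0mx.
have [|v v0 [fv bv]] := forms_common_zero m0 (ltn0Sn 0) hf (linform_homog a^T) f0.
  by rewrite linform_eq0.
exists v; split=> // u c us c0 ev; move: bv; rewrite mev_linform ev -scalemxAr mxE.
move/eqP; rewrite mulf_eq0 (negPf c0) /= => /eqP au.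
have /bu/negP[] : u \in s'.
  by rewrite inE mem_filter us andbT orbC; apply/orP; left;
    apply: contraNneq v0 => u0; rewrite ev u0 scaler0.
by apply/eqP/matrixP => i j; rewrite !ord1 au mxE.
Qed.

(* If D_p f = 0, then f is a cone with vertex p and contains the lines joining
   p to its other zeros. *)
Lemma polar_neq0 m f p : irreducible_form m f -> (1 < m)%N -> p != 0 -> polar f p != 0.
Proof.
move=> irr m1 p0; apply/eqP => pf0; have [m0 hf f0 _] := irr.
have [||A uA Ae] := @unitmx_transitive K 3 (vec3 0 0 1) p => //.
  by apply/cV0Pn; exists 2%:R; rewrite mxE oner_neq0.
pose g := mcomp A f; have irrg : irreducible_form m g := irreducible_form_comp uA irr.
have [_ hg g0 _] := irrg.
have inv v t : mev g (v + t *: vec3 0 0 1) = mev g v.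
  rewrite !mev_comp mulmxDr -scalemxAr Ae -horner_lres.
  have /size1_polyC -> : (size (lres f (A *m v) p) <= 1)%N.
    apply/leq_sizeP => -[//|i] _; have := congr1 (fun q : {poly K} => q`_i) (deriv_lres f (A *m v) p).
    rewrite pf0 /lres mmap0 coef0 coef_deriv => /eqP.
    by rewrite -mulr_natr mulf_eq0 pnatr_eq0 orbF => /eqP.
  by rewrite -horner_coef0 hornerC horner_lres scale0r addr0.
have [v [v0 gv vN]] := form_zero_avoiding [:: vec3 0 0 1] m0 hg g0.
have vE : v = vec3 (v 0 0) (v 1 0) 0 + v 2%:R 0 *: vec3 0 0 1.
  rewrite {1}[v]vec3P.
  by apply/colP => -[[|[|[|//]]]] ?; rewrite !mxE /= ?mulr0 ?mulr1 ?addr0 ?add0r.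
have v01 : (v 0 0 != 0) || (v 1 0 != 0).
  rewrite -negb_and; apply/negP => /andP[/eqP v00 /eqP v10].
  apply: (vN (vec3 0 0 1) (v 2%:R 0)); rewrite ?mem_head //; last first.
    by rewrite {1}vE v00 v10; apply/colP => -[[|[|[|//]]]] ?; rewrite !mxE /= add0r.
  apply: contraNneq v0 => v20; rewrite vE v00 v10 v20 scale0r addr0.
  by apply/eqP/colP => -[[|[|[|//]]]] ?; rewrite !mxE.
pose a : 'rV[K]_3 := row3 (v 1 0) (- v 0 0) 0.
have a0 : a != 0.
  apply/rV0Pn; case/orP: v01 => [v00|v10]; [exists 1|exists 0]; rewrite mxE //=.
  by rewrite oppr_eq0.
apply: (irreducible_linform irrg m1 a0); apply/linform_dvdP => // x ax.
have [k [kx ky]] : exists k, x 0 0 = k * v 0 0 /\ x 1 0 = k * v 1 0.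
  have := congr1 (fun M : 'M[K]_1 => M 0 0) ax.
  rewrite !mxE !(big_ord_recl, big_ord0) !mxE /= mul0r !addr0.
  have -> : lift 0 0 = 1 :> 'I_3 by apply: val_inj.
  move=> e; case/orP: v01 => [v00|v10].
    exists (x 0 0 / v 0 0); rewrite divfK //; split=> //.
    by apply: (mulfI v00); move/eqP: e; rewrite mulNr subr_eq0 => /eqP <-; field.
  exists (x 1 0 / v 1 0); rewrite divfK //; split=> //.
  by apply: (mulfI v10); move/eqP: e; rewrite mulNr subr_eq0 => /eqP ->; field.
have -> : x = k *: v + (x 2%:R 0 - k * v 2%:R 0) *: vec3 0 0 1.
  rewrite {1}[x]vec3P {1}[v]vec3P kx ky.
  by apply/colP => -[[|[|[|//]]]] ?; rewrite !mxE /=; ring.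
by rewrite inv (mev_homogZ _ _ hg) gv mulr0.
Qed.

(** By Euler's relation in characteristic 0 some partial derivative is nonzero. Its degree is too
    small for [f] to divide it, so it vanishes at finitely many points of the curve, and the curve
    has others. *)
Lemma irreducible_smooth_point m f : irreducible_form m f ->
  exists p i, [/\ p != 0, mev f p = 0 & mev f^`M(i) p != 0].
Proof.
move=> irr; have [m0 hf f0 _] := irr.
have [i fi0] : exists i, f^`M(i) != 0.
  apply: contrapT => nex; case/eqP: f0; apply/eqP.
  have : f *+ m == 0.
    rewrite -(euler_homog hf) big1 // => i _.
    have -> : f^`M(i) = 0 by apply: contrapT => /eqP fi; apply: nex; exists i.
    by rewrite mulr0.
  by rewrite -scaler_nat scaler_eq0 pnatr_eq0 eqn0Ngt m0.
have hfi := mderiv_homog i hf.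
have ndvd : ~ mdvd f f^`M(i).
  case=> Q; rewrite mulrC => eQ; rewrite eQ in fi0 hfi.
  have [+ _] := dhomog_div hf fi0 hfi.
  by rewrite leqNgt ltn_predL m0.
have [s sP] := irreducible_common_zeros irr hfi ndvd.
have [p [p0 fp pN]] := form_zero_avoiding s m0 hf f0.
exists p, i; split=> //; apply/eqP => fip.
by have [c c0 [u us /(pN _ _ us c0)]] := sP p (And3 p0 fp fip).
Qed.

(** The hypothesis expands det S = phi R for the symmetric matrix S with rows (m n phi, n phi', n
    g), (n phi', D, x), (n g, x, y), where phi = X a and phi' = X v. Every term but the one in g^2 D
    is a multiple of [X]. *)
Lemma gram_identity (S : comNzRingType) (X a v D g x y R : S) m n :
  X * a * R = (X * a) *+ m *+ n * (D * y - x * x)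
    - (X * v) *+ n * ((X * v) *+ n * y - x * (g *+ n))
    + g *+ n * ((X * v) *+ n * x - D * (g *+ n)) ->
  (g *+ n) ^+ 2 * D = X * (a * ((D * y - x * x) *+ m *+ n - R)
    - v *+ n * ((X * v) *+ n * y - x * (g *+ n)) + g *+ n * (v *+ n * x)).
Proof.
move=> /eqP; rewrite -subr_eq0 => /eqP z; apply/eqP; rewrite -subr_eq0.
by apply/eqP; rewrite -[RHS]z; ring.
Qed.

(** With [X = 'X^(k.+1)] in [gram_identity], phi'' would have order at least k + 1 at 0. But its
    order is exactly k, with leading coefficient (k + 2)(k + 1) u(0), nonzero in characteristic
    0. *)
Lemma tangent_order (phi g R x y u : {poly K}) m n k :
  phi = u * 'X^(k.+2) -> u.[0] != 0 -> g.[0] != 0 -> (0 < n)%N ->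
  phi * R = phi *+ m *+ n * (phi^`()^`() * y - x * x)
    - phi^`() *+ n * (phi^`() *+ n * y - x * (g *+ n))
    + g *+ n * (phi^`() *+ n * x - phi^`()^`() * (g *+ n)) -> False.
Proof.
move=> ephi u0 g0 n0 eS; pose v : {poly K} := u^`() * 'X + u *+ k.+2.
have phi'E : phi^`() = 'X^(k.+1) * v.
  by rewrite ephi derivM derivXn /v !exprS; ring.
have phi''E : phi^`()^`() = 'X^k * (v^`() * 'X + v *+ k.+1).
  by rewrite phi'E derivM derivXn !exprS; ring.
have phiE : phi = 'X^(k.+1) * ('X * u) by rewrite ephi [in LHS]exprSr; ring.
move: (phi^`()^`()) phi''E eS => D DE; rewrite phi'E phiE.
move=> /gram_identity; rewrite DE [in 'X^(k.+1)]exprSr => e.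
have Xk0 : 'X^k != 0 :> {poly K} by rewrite monic_neq0 ?monicXn.
move: e; rewrite mulrCA -[RHS]mulrA => /(mulfI Xk0).
have L : (v^`() * 'X + v *+ k.+1).[0] = u.[0] *+ k.+2 *+ k.+1.
  by rewrite hornerD hornerMn hornerM hornerX mulr0 add0r /v hornerD hornerMn
    hornerM hornerX mulr0 add0r.
move/(congr1 (fun q : {poly K} => q.[0])) => /eqP.
rewrite hornerM L horner_exp hornerMn hornerM hornerX mul0r.
by rewrite mulf_eq0 sqrf_eq0 !mulrn_eq0 (negPf g0) (negPf u0) eqn0Ngt n0.
Qed.

(* Along the tangent line to f at a smooth point, f restricts to phi = t^k u(t)
   with k >= 2, and the Hessian is congruent to a unit times phi'', hence has
   order exactly k - 2. *)
Lemma irreducible_hess m f : irreducible_form m f -> (1 < m)%N -> ~ mdvd f (hess f).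
Proof.
move=> irr m1 [Q eQ]; have [m0 hf f0 _] := irr.
have [p [i0 [p0 fp fip]]] := irreducible_smooth_point irr.
pose a : 'rV[K]_3 := \row_i mev f^`M(i) p.
have a0 : a != 0 by apply/rV0Pn; exists i0; rewrite mxE.
(* Otherwise [f] would vanish on its tangent line at [p], whose equation would divide it. *)
have [w aw phi0] : exists2 w, a *m w = 0 & lres f p w != 0.
  apply: contrapT => nex; apply: (irreducible_linform irr m1 a0).
  apply/linform_dvdP => // w aw; have [_ <-] := lres_top p w hf.
  have -> : lres f p w = 0 by apply: contrapT => /eqP fw; apply: nex; exists w.
  by rewrite coef0.
set phi := lres f p w in phi0.
have phi_0 : phi.[0] = 0 by rewrite horner_lres scale0r addr0.
have dphi_0 : phi^`().[0] = 0.
  rewrite deriv_lres horner_lres scale0r addr0 mev_sum.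
  transitivity ((a *m w) 0 0); last by rewrite aw mxE.
  by rewrite mxE; apply: eq_bigr => i _; rewrite mevZ mxE mulrC.
have [k [u u0 ephi]] := multiplicity_XsubC phi 0; rewrite phi0 subr0 /= in u0 ephi.
have k2 : (1 < k)%N.
  case: k ephi => [|[|//]] ephi.
    by case/negP: u0; apply/rootP; move: phi_0; rewrite ephi mulr1.
  case/negP: u0; apply/rootP; move: dphi_0.
  by rewrite ephi expr1 derivM derivX mulr1 !hornerE ?mulr0 ?add0r.
case: k k2 ephi => [|[|k]] // _ ephi.
pose L F := lres F p w; pose P i : {poly K} := (p i 0)%:P + w i 0 *: 'X.
have LX i : L 'X_i = P i by apply: mmapXU.
have LM F G : L (F * G) = L F * L G by apply: rmorphM.
have Ls (E : 'I_3 -> {mpoly K[3]}) : L (\sum_i E i) = \sum_i L (E i) by apply: raddf_sum.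
have LMn F n : L (F *+ n) = L F *+ n by apply: raddfMn.
have LZ c F : L (c *: F) = c%:P * L F by apply: mmapZ.
have dL F : (L F)^`() = \sum_i (w i 0)%:P * L F^`M(i).
  by rewrite /L deriv_lres [lres _ _ _](Ls _); apply: eq_bigr => i _; rewrite LZ.
have eulerL F d : F \is d.-homog -> \sum_i P i * L F^`M(i) = L F *+ d.
  by move=> hF; rewrite -LMn -(euler_homog hF) Ls; apply: eq_bigr => i _; rewrite LM LX.
pose H : 'M[{poly K}]_3 := \matrix_(i, j) L f^`M(i)^`M(j).
(* The rows of [N] are the moving point [P], the tangent direction [w] and the basis vector of index
   [i0]. In this frame Euler's relation expresses the entries of the Hessian through phi, its
   derivatives and the partial [g i0], which is nonzero at [p]; only [x] and [y] stay unknown. *)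
pose N : 'M[{poly K}]_3 := \matrix_(r, i)
  [:: P i; (w i 0)%:P; (i == i0)%:R]`_r.
pose S : 'M[{poly K}]_3 := N *m H *m N^T.
have detS : exists R, \det S = phi * R.
  exists (L Q * \det N ^+ 2); rewrite !det_mulmx det_tr.
  have -> : \det H = L Q * phi by rewrite -[L Q * phi]LM -eQ /L lres_hess.
  ring.
pose g i := L f^`M(i).
have HE r s : S r s = \sum_i N r i * \sum_j H i j * N s j.
  rewrite /S -mulmxA mxE; apply: eq_bigr => i _; congr (_ * _); rewrite mxE.
  by apply: eq_bigr => j _; rewrite [N^T _ _]mxE.
have HP i : \sum_j H i j * N 0 j = g i *+ m.-1.
  rewrite -(eulerL _ _ (mderiv_homog i hf)); apply: eq_bigr => j _.
  by rewrite !mxE mulrC.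
have Hw i : \sum_j H i j * N 1 j = (g i)^`().
  by rewrite dL; apply: eq_bigr => j _; rewrite !mxE mulrC.
have Nn (E : 'I_3 -> {poly K}) : \sum_j N 2%:R j * E j = E i0.
  rewrite (bigD1 i0) //= big1 ?addr0 => [|j jN]; rewrite !mxE /= ?eqxx ?mul1r //.
  by rewrite (negPf jN) mul0r.
have Hsym i j : H i j = H j i by rewrite !mxE mderiv_comm.
have Ssym r s : S r s = S s r.
  rewrite !HE; under eq_bigr => i _ do rewrite mulr_sumr.
  rewrite exchange_big; apply: eq_bigr => j _; rewrite mulr_sumr.
  by apply: eq_bigr => i _; rewrite Hsym; ring.
have S00 : S 0 0 = phi *+ m *+ m.-1.
  rewrite HE; under eq_bigr => i _ do rewrite HP mulrnAr.
  rewrite sumrMnl; congr (_ *+ _); rewrite -[RHS](eulerL _ _ hf).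
  by apply: eq_bigr => i _; rewrite mxE.
have S10 : S 1 0 = phi^`() *+ m.-1.
  rewrite HE; under eq_bigr => i _ do rewrite HP mulrnAr.
  by rewrite sumrMnl [phi^`()]dL; congr (_ *+ _); apply: eq_bigr => i _; rewrite mxE.
have S11 : S 1 1 = phi^`()^`().
  rewrite HE; under eq_bigr => i _ do rewrite Hw.
  rewrite [phi^`()]dL raddf_sum; apply: eq_bigr => i _ /=.
  by rewrite derivM derivC mul0r add0r mxE.
have S20 : S 2%:R 0 = g i0 *+ m.-1 by rewrite HE Nn HP.
have := det_mx33 S; rewrite [S 0 1]Ssym [S 0 2%:R]Ssym [S 1 2%:R]Ssym S00 S10 S11 S20.
set x := S 2%:R 1; set y := S 2%:R 2%:R; have [R ->] := detS => eS.
apply: (tangent_order ephi _ _ _ eS); first by apply: contra u0 => /eqP/rootP.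
  by rewrite /g /L horner_lres scale0r addr0.
by rewrite -ltnS prednK.
Qed.

End Flexes.
(** * Forms with a finite projective orbit *)

Section FiniteOrbits.
Context (K : numClosedFieldType).
Implicit Types (F G f g h : {mpoly K[3]}) (u v w p : 'cV[K]_3) (Gm : 'M[K]_3 -> Prop).

Definition matrix_group Gm := [/\ Gm 1%:M,
  forall A B, Gm A -> Gm B -> Gm (A *m B), forall A, Gm A -> Gm (invmx A) &
  forall A, Gm A -> A \in unitmx].

Definition finite_orbit Gm F :=
  proj_finite (fun F' => exists2 A, Gm A & F' = mcomp A F).

Lemma finite_orbit_invariant Gm F e g d : (forall A, Gm A -> A \in unitmx) ->
  (forall A v, Gm A -> v != 0 -> mev F (A *m v) = 0 -> mev F v = 0) ->
  (0 < e)%N -> F \is e.-homog -> F != 0 -> g \is d.-homog -> g != 0 ->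
  (forall v, v != 0 -> mev g v = 0 -> mev F v = 0) -> finite_orbit Gm g.
Proof.
move=> GU FG e0 hF F0 hg g0 gF.
apply: proj_finiteS (proj_finite_zero_locus_sub d e0 hF F0) => _ [A GA ->].
split; [exact: mcomp_homog | by rewrite mcomp_eq0 ?GU |] => v v0.
rewrite mev_comp => gAv; apply: (FG _ _ GA v0); apply: gF gAv.
by apply: contraNneq v0 => Av0; rewrite -[v](mulKmx (GU _ GA)) Av0 mulmx0.
Qed.

(** Sort the translates of [g] by the translate of [F] containing their zeros: there are finitely
    many classes, each finite by [proj_finite_zero_locus_sub]. Taking for [g] a factor of [F] shows
    that factors inherit finite orbits. *)
Lemma finite_orbit_sub Gm F e g d : (forall A, Gm A -> A \in unitmx) ->
  (0 < e)%N -> F \is e.-homog -> F != 0 -> g \is d.-homog -> g != 0 ->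
  finite_orbit Gm F ->
  (forall v, v != 0 -> mev g v = 0 -> mev F v = 0) -> finite_orbit Gm g.
Proof.
move=> GU e0 hF F0 hg g0 [s sP] gF.
apply: proj_finiteS (@proj_finite_bigcup _ _ _ s (fun x g' => exists A c,
  [/\ Gm A, c != 0, mcomp A F = c *: x & g' = mcomp A g]) _).
  move=> _ [A GA ->]; have [|c c0 [x xs ex]] := sP (mcomp A F); first by exists A.
  by exists x => //; exists A, c.
move=> x _; have [[A [c [GA c0 ex]]]|nex] :=
    pselect (exists A c, [/\ Gm A, c != 0 & mcomp A F = c *: x]); last first.
  by exists [::] => g' [A [c [GA c0 ex _]]]; case: nex; exists A, c.
have x0 : x != 0.
  by have := F0; rewrite -(mcomp_eq0 F (GU _ GA)) ex scaler_eq0 negb_or c0.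
have hx : x \is e.-homog.
  by rewrite -[x]scale1r -(mulVf c0) -scalerA -ex dhomogZ ?mcomp_homog.
apply: proj_finiteS (proj_finite_zero_locus_sub d e0 hx x0) => _ [B [b [GB b0 ex' ->]]].
split; [exact: mcomp_homog | by rewrite mcomp_eq0 ?GU |] => v v0.
rewrite mev_comp => gBv; have : mev (mcomp B F) v = 0.
  rewrite mev_comp; apply: gF gBv.
  by apply: contraNneq v0 => Bv0; rewrite -[v](mulKmx (GU _ GB)) Bv0 mulmx0.
by rewrite ex' mevZ => /eqP; rewrite mulf_eq0 (negPf b0) => /eqP.
Qed.

(* Minimality is among all forms with a finite orbit, whether or not their zeros
   lie on the invariant curve: this is what rules out finite orbits of points. *)
Definition minimal_form Gm m f := [/\ (0 < m)%N, f \is m.-homog, f != 0,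
  finite_orbit Gm f & forall d g, (0 < d < m)%N -> g \is d.-homog -> g != 0 ->
  ~ finite_orbit Gm g].

Lemma minimal_form_exists Gm m f : (0 < m)%N -> f \is m.-homog -> f != 0 ->
  finite_orbit Gm f -> exists d g, minimal_form Gm d g.
Proof.
elim/ltn_ind: m f => m IH f m0 hf f0 Gf.
have [[d [g [/andP[d0 dm] hg g0 Gg]]]|nex] := pselect (exists d g,
  [/\ (0 < d < m)%N, g \is d.-homog, g != 0 & finite_orbit Gm g]).
  exact: IH d dm g d0 hg g0 Gg.
by exists m, f; split=> // d g dm hg g0 Gg; apply: nex; exists d, g.
Qed.

Context (Gm : 'M[K]_3 -> Prop) (GmG : matrix_group Gm).

Let GU A : Gm A -> A \in unitmx. Proof. by case: GmG => _ _ _; apply. Qed.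
Let GM A B : Gm A -> Gm B -> Gm (A *m B). Proof. by case: GmG => _ + _ _; apply. Qed.
Let GV A : Gm A -> Gm (invmx A). Proof. by case: GmG => _ _ + _; apply. Qed.

Lemma minimal_irreducible m f : minimal_form Gm m f -> irreducible_form m f.
Proof.
move=> [m0 hf f0 Gf mf]; split=> // d g q dm hg ef.
have g0 : g != 0 by apply: contraNneq f0 => g0; rewrite ef g0 mulr0.
apply: (mf d g dm hg g0); apply: finite_orbit_sub GU m0 hf f0 hg g0 Gf _ => v _ gv.
by rewrite ef mevM gv mulr0.
Qed.

(** Composing the polar of [f] at [p] with [A] gives the polar of [mcomp A f] at [A^-1 p], hence one
    of finitely many forms at one of finitely many points, up to scalars. *)
Lemma minimal_no_finite_point_orbit m f p : minimal_form Gm m f -> (1 < m)%N ->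
  p != 0 -> ~ proj_finite (fun u => exists2 A, Gm A & u = A *m p).
Proof.
move=> minf m1 p0 [t tP]; have irr := minimal_irreducible minf.
have [m0 hf f0 [s sP] mf] := minf.
apply: (mf m.-1 (polar f p)).
- by rewrite -ltnS prednK // m1 leqnn.
- exact: polar_homog.
- exact: (polar_neq0 irr m1 p0).
exists [seq polar F u | F <- s, u <- t] => _ [A GA ->].
have [|c c0 [F Fs eF]] := sP (mcomp A f); first by exists A.
have [|b b0 [u ut eu]] := tP (invmx A *m p); first by exists (invmx A) => //; exact: GV.
exists (c * b); first by rewrite mulf_neq0.
exists (polar F u); first exact: allpairs_f.
have -> : mcomp A (polar f p) = polar (mcomp A f) (invmx A *m p).
  by apply: mpoly_mevP => v; rewrite mev_comp polar_comp mulKVmx ?GU.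
rewrite eF eu /polar scaler_sumr; apply: eq_bigr => i _.
by rewrite mderivZ !mxE !scalerA; congr (_ *: _); ring.
Qed.

(** For [m >= 3] the Hessian has positive degree, so a flex [p] exists. Its translate by [A] is a
    flex of [f] composed with [A^-1], one of finitely many forms up to scalars, each irreducible and
    so with finitely many flexes. *)
Lemma minimal_degree_le2 m f : minimal_form Gm m f -> (m <= 2)%N.
Proof.
move=> minf; rewrite leqNgt; apply/negP => m2; have m1 := ltnW m2.
have irr := minimal_irreducible minf; have ndvd := irreducible_hess irr m1.
have [m0 hf f0 [s sP] mf] := minf.
have hess0 : hess f != 0.
  by apply/eqP => h0; apply: ndvd; exists 0; rewrite h0 mul0r.
have [|p p0 [fp hp]] := forms_common_zero m0 _ hf (hess_homog hf) f0 hess0.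
  by rewrite muln_gt0 /=; case: (m) m2 => [|[|[|]]].
apply: (minimal_no_finite_point_orbit minf m1 p0).
apply: proj_finiteS (@proj_finite_bigcup _ _ _ s (fun x u => exists A c,
  [/\ Gm A, c != 0, mcomp A f = c *: x &
    [/\ u != 0, mev (mcomp A f) u = 0 & mev (hess (mcomp A f)) u = 0]]) _).
  move=> _ [A GA ->]; have [|c c0 [x xs ex]] := sP (mcomp (invmx A) f).
    by exists (invmx A) => //; apply: GV.
  exists x => //; exists (invmx A), c; split=> //; first exact: GV.
  rewrite mev_comp mev_hess hmx_comp !mulKmx ?GU // fp.
  rewrite !det_mulmx -mev_hess hp mulr0 mul0r; split=> //.
  by apply: contraNneq p0 => Ap0; rewrite -[p](mulKmx (GU GA)) Ap0 mulmx0.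
move=> x _; have [[A [c [GA c0 ex]]]|nex] :=
    pselect (exists A c, [/\ Gm A, c != 0 & mcomp A f = c *: x]); last first.
  by exists [::] => u [A [c [GA c0 ex _]]]; case: nex; exists A, c.
have irrA := irreducible_form_comp (GU GA) irr; have [_ hfA _ _] := irrA.
apply: proj_finiteS (irreducible_common_zeros irrA (hess_homog hfA)
  (irreducible_hess irrA m1)) => u [B [b [GB b0 ex' [u0 fBu hBu]]]].
have eAB : mcomp A f = (c / b) *: mcomp B f by rewrite ex' scalerA divfK.
split; [exact: u0 | by rewrite eAB mevZ fBu mulr0 |].
by rewrite eAB mev_hess hmxZ detZ -mev_hess hBu mulr0.
Qed.

Lemma polar_quadratic f p v : f \is 2.-homog -> mev (polar f p) v = (v^T *m hmx f 0 *m p) 0 0.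
Proof.
move=> hf; have d2 i j : mev f^`M(i)^`M(j) v = mev f^`M(i)^`M(j) 0.
  by rewrite (dhomog0_const (mderiv_homog j (mderiv_homog i hf))) !mevC.
rewrite -[_ 0 0]mulr1 -mulmxA !mxE mulr1 mev_sum.
under [RHS]eq_bigr => i _ do rewrite !mxE mulr_sumr.
rewrite exchange_big /=; apply: eq_bigr => i _; rewrite mevZ.
rewrite -[f^`M(i)]mulr1n -(euler_homog (mderiv_homog i hf)) mev_sum mulr_sumr.
apply: eq_bigr => j _; rewrite mevM mevX d2 !mxE mderiv_comm; ring.
Qed.

(** The polar of [f] at a kernel vector of its Gram matrix would vanish, making the conic a cone. *)
Lemma minimal_quadratic_unitmx f : minimal_form Gm 2 f -> hmx f 0 \in unitmx.
Proof.
move=> minf; rewrite -unitmx_tr; apply: contrapT => /negP.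
rewrite unitmxE unitfE negbK => /det0P[q q0 qM].
have p0 : q^T != 0 by rewrite -trmx0 (inj_eq trmx_inj).
have [_ hf _ _ _] := minf.
case/eqP: (polar_neq0 (minimal_irreducible minf) isT p0).
apply: mpoly_mevP => v; rewrite polar_quadratic // mev0 -mulmxA.
by rewrite -[hmx f 0]trmxK -trmx_mul qM trmx0 mulmx0 mxE.
Qed.

(** A translate of the degenerate conic [g] is, up to a scalar, a degenerate member [F1 - x F2] of a
    pencil with [F1], [F2] in the finite list [s]. Such [x] are eigenvalues of [M(F2)^-1 M(F1)], so
    finitely many candidates remain. *)
Lemma minimal_quadratic_fixed f A : minimal_form Gm 2 f -> Gm A ->
  exists2 c, c != 0 & mcomp A f = c *: f.
Proof.
move=> minf GA; apply: contrapT => nprop.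
have [_ hf f0 [s sP] mf] := minf.
pose M F := hmx F 0; have uM := minimal_quadratic_unitmx minf.
have MB B : Gm B -> M (mcomp B f) \in unitmx.
  move=> GB; rewrite /M hmx_comp mulmx0 !unitmx_mul unitmx_tr uM.
  by rewrite GU.
pose chi F1 F2 := char_poly (invmx (M F2) *m M F1).
have chiP F1 F2 k : M F2 \in unitmx -> root (chi F1 F2) k =
    (\det (M (F1 - k *: F2)) == 0).
  move=> u2; rewrite -eigenvalue_root_char /M hmxB hmxZ -/(M _) -/(M _).
  have -> : M F1 - k *: M F2 = M F2 *m (invmx (M F2) *m M F1 - k%:M).
    by rewrite mulmxBr mulKVmx // mul_mx_scalar.
  rewrite det_mulmx mulf_eq0 -[\det (M F2) == 0]negbK -unitfE -unitmxE u2 /=.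
  apply/eigenvalueP/det0P => -[v].
    by move=> ev v0; exists v; rewrite // mulmxBr ev mul_mx_scalar subrr.
  by move=> v0 /eqP; rewrite mulmxBr mul_mx_scalar subr_eq0 => /eqP; exists v.
have [k] : exists k, root (chi (mcomp A f) f) k.
  by apply/closed_rootP; rewrite size_char_poly.
rewrite chiP // => /eqP detk; pose g := mcomp A f - k *: f.
have hg : g \is 2.-homog by rewrite rpredB ?dhomogZ ?mcomp_homog.
have g0 : g != 0.
  rewrite subr_eq0; apply/eqP => e; apply: nprop; exists k => //.
  by apply: contraNneq f0 => k0; rewrite -(mcomp_eq0 f (GU GA)) e k0 scale0r.
(* Minimality is a condition on the degree, so [g] would be minimal as well, hence nondegenerate. *)
suff Gg : finite_orbit Gm g.
  have ming : minimal_form Gm 2 g by split.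
  by have := minimal_quadratic_unitmx ming; rewrite unitmxE unitfE -/(M g) detk eqxx.
pose r F1 F2 := sval (closed_field_poly_normal (chi F1 F2)).
have rP F1 F2 x : root (chi F1 F2) x -> x \in r F1 F2.
  rewrite /r; case: closed_field_poly_normal => t /= ->.
  by rewrite (monicP (char_poly_monic _)) scale1r root_prod_XsubC.
exists [seq F.1 - x *: F.2 | F : {mpoly K[3]} * {mpoly K[3]} <-
  [seq (F1, F2) | F1 <- s, F2 <- s],
  x : K <- r F.1 F.2].
move=> _ [B GB ->].
have [|c1 c10 [F1 F1s e1]] := sP (mcomp (A *m B) f); first by exists (A *m B) => //; exact: GM.
have [|c2 c20 [F2 F2s e2]] := sP (mcomp B f); first by exists B.
have eg : mcomp B g = c1 *: (F1 - (k * c2 / c1) *: F2).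
  rewrite /g mcompB mcompZ mcomp_comp e1 e2 scalerBr !scalerA; congr (_ - _ *: _).
  by field.
exists c1 => //; exists (F1 - (k * c2 / c1) *: F2) => //.
apply/allpairsPdep; exists (F1, F2), (k * c2 / c1); split=> //=.
  exact: allpairs_f.
have u2 : M F2 \in unitmx.
  by have := MB B GB; rewrite e2 /M hmxZ unitmxZ ?unitfE.
apply: rP; rewrite chiP //.
have -> : F1 - (k * c2 / c1) *: F2 = c1^-1 *: mcomp B g.
  by rewrite eg scalerA mulVf ?scale1r.
rewrite /M hmxZ detZ.
by rewrite hmx_comp mulmx0 !det_mulmx -/(M g) detk mulr0 mul0r mulr0.
Qed.

End FiniteOrbits.
(** * The Veronese conic and its stabilizer *)

Lemma sum3 (S : nmodType) (E : 'I_3 -> S) : \sum_i E i = E 0 + E 1 + E 2%:R.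
Proof.
rewrite !(big_ord_recl, big_ord0) /= addr0 addrA.
by congr (E _ + E _ + E _); apply: val_inj.
Qed.

Section Conics.
Context (K : numClosedFieldType).
Implicit Types (M B : 'M[K]_3) (u v w p q : 'cV[K]_3).

(* The Gram matrix of y^2 - 4xz, which vanishes at (s^2, 2st, t^2). *)
Definition conic_mx : 'M[K]_3 := \matrix_(i, j)
  (nth [::] [:: [:: 0; 0; -2]; [:: 0; 1; 0]; [:: -2; 0; 0]] i)`_j.

Definition bform M u v : K := (u^T *m M *m v) 0 0.

Lemma bformDr M u v w : bform M u (v + w) = bform M u v + bform M u w.
Proof. by rewrite /bform mulmxDr mxE. Qed.

Lemma bformZr M u c v : bform M u (c *: v) = c * bform M u v.
Proof. by rewrite /bform -scalemxAr mxE. Qed.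

Lemma bform0r M u : bform M u 0 = 0.
Proof. by rewrite /bform mulmx0 mxE. Qed.

Lemma bform_sym M u v : M^T = M -> bform M u v = bform M v u.
Proof.
move=> Ms; have e : (u^T *m M *m v)^T = v^T *m M *m u.
  by rewrite !trmx_mul trmxK Ms mulmxA.
by rewrite /bform -e [RHS]mxE.
Qed.

Lemma bform_mx M (P : 'M[K]_3) i j : (P^T *m M *m P) i j = bform M (col i P) (col j P).
Proof.
rewrite /bform !mxE; apply: eq_bigr => k _; rewrite !mxE; congr (_ * _).
by apply: eq_bigr => l _; rewrite !mxE.
Qed.

Lemma isotropic_vector M : M^T = M -> exists2 p, p != 0 & bform M p p = 0.
Proof.
move=> Ms; pose e : 'cV[K]_3 := vec3 1 0 0; pose e' : 'cV[K]_3 := vec3 0 1 0.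
have [a0|a0] := eqVneq (bform M e e) 0.
  by exists e => //; apply/cV0Pn; exists 0; rewrite mxE oner_neq0.
set a := bform M e e in a0; set b := bform M e e'; set c := bform M e' e'.
pose t := (- b + sqrtC (b ^+ 2 - a * c)) / a.
exists (e' + t *: e).
  by apply/cV0Pn; exists 1; rewrite !mxE /= mulr0 addr0 oner_neq0.
rewrite bformDr bformZr ![bform M (_ + _) _]bform_sym // !bformDr !bformZr.
rewrite [bform M e' e]bform_sym // -/a -/b -/c.
have -> : c + t * b + t * (b + t * a) = (c * a + (t * a) * b *+ 2 + (t * a) ^+ 2) / a.
  by field.
rewrite /t divfK //; set s := sqrtC _.
have -> : c * a + (- b + s) * b *+ 2 + (- b + s) ^+ 2 = s ^+ 2 - (b ^+ 2 - a * c) by ring.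
by rewrite sqrtCK subrr mul0r.
Qed.

(** An isotropic [p] is completed to a hyperbolic pair [p], [q] of value -2, and a vector orthogonal
    to both is scaled to value 1. Nondegeneracy of [M] forbids that vector to be isotropic. *)
Lemma conic_normal_form M : M^T = M -> M \in unitmx ->
  exists2 P, P \in unitmx & P^T *m M *m P = conic_mx.
Proof.
move=> Ms uM; have [p p0 pp] := isotropic_vector Ms.
have [w pw] : exists w, bform M p w != 0.
  have : p^T *m M != 0.
    apply: contraNneq p0 => e; rewrite -[p]trmxK -[p^T](mulmxK uM) e mul0mx.
    by rewrite trmx0.
  move=> /rV0Pn[k ek]; exists (delta_mx k 0).
  by rewrite /bform -colE mxE.
(* The multiple of [p] is chosen to cancel the value of the form at [w]; the pairing with [p] is
   unchanged because [p] is isotropic. *)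
pose q0 := w - (bform M w w / (2 * bform M p w)) *: p.
have pq0 : bform M p q0 = bform M p w.
  by rewrite /q0 -scaleNr bformDr bformZr pp mulr0 addr0.
have q00 : bform M q0 q0 = 0.
  rewrite {2}/q0 -scaleNr bformDr bformZr [bform M q0 p]bform_sym // pq0.
  rewrite [bform M q0 w]bform_sym // /q0 -scaleNr bformDr bformZr.
  rewrite [bform M w p]bform_sym //; by field.
pose q := (- 2 / bform M p w) *: q0.
have pq : bform M p q = -2 by rewrite /q bformZr pq0 divfK.
have qq : bform M q q = 0.
  by rewrite /q bformZr [bform M (_ *: _) _]bform_sym // bformZr q00 !mulr0.
clearbody q.
have [r0 r00 [pr qr]] : exists2 r, r != 0 & bform M p r = 0 /\ bform M q r = 0.
  pose N : 'M[K]_(1 + 1, 3) := col_mx (p^T *m M) (q^T *m M).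
  have : kermx N^T != 0.
    rewrite -mxrank_eq0 mxrank_ker mxrank_tr subn_eq0 -ltnNge.
    exact: leq_ltn_trans (rank_leq_row _) _.
  case/rowV0Pn => k /sub_kermxP kN k0.
  have Nk : N *m k^T = 0 by rewrite -[N]trmxK -trmx_mul kN trmx0.
  move: Nk; rewrite mul_col_mx => /eqP; rewrite col_mx_eq0 => /andP[/eqP pk /eqP qk].
  exists k^T; first by rewrite -trmx0 (inj_eq trmx_inj).
  by rewrite /bform pk qk !mxE.
pose mk (r : 'cV[K]_3) : 'M[K]_3 := \matrix_(i, j) [:: p i 0; r i 0; q i 0]`_j.
have mkc r : [/\ col 0 (mk r) = p, col 1 (mk r) = r & col 2%:R (mk r) = q].
  by split; apply/colP => i; rewrite !mxE.
have ord3 (i : 'I_3) : [\/ i = 0, i = 1 | i = 2%:R].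
  case: i => -[|[|[|//]]] lt3; [apply: Or31|apply: Or32|apply: Or33]; exact: val_inj.
have mkE r : bform M p r = 0 -> bform M q r = 0 ->
    (mk r)^T *m M *m mk r = \matrix_(i, j)
      (nth [::] [:: [:: 0; 0; -2]; [:: 0; bform M r r; 0]; [:: -2; 0; 0]] i)`_j.
  move=> pr' qr'; have [c0 c1 c2] := mkc r; apply/matrixP => i j; rewrite bform_mx mxE.
  by case: (ord3 i) => ->; case: (ord3 j) => ->; rewrite ?c0 ?c1 ?c2 //= 1?bform_sym.
have uP : mk r0 \in unitmx.
  rewrite -unitmx_tr; apply: contrapT => /negP; rewrite unitmxE unitfE negbK.
  move=> /det0P[k k0 kP].
  have Pk : mk r0 *m k^T = 0 by rewrite -[mk r0]trmxK -trmx_mul kP trmx0.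
  have ePk : k 0 0 *: p + k 0 1 *: r0 + k 0 2%:R *: q = 0.
    by rewrite -{}Pk; apply/colP => i; rewrite [RHS]mxE sum3 !mxE /=; ring.
  have := congr1 (bform M p) ePk; have := congr1 (bform M q) ePk.
  rewrite !bformDr !bformZr !bform0r pp pq pr qr qq.
  rewrite [bform M q p]bform_sym // pq !mulr0 !addr0 !add0r.
  move=> /eqP; rewrite mulf_eq0 oppr_eq0 pnatr_eq0 orbF => /eqP k00.
  move=> /eqP; rewrite mulf_eq0 oppr_eq0 pnatr_eq0 orbF => /eqP k02.
  move: ePk; rewrite k00 k02 !scale0r add0r addr0 => /eqP.
  rewrite scaler_eq0 (negPf r00) orbF => /eqP k01.
  case/eqP: k0; apply/rowP => i; rewrite mxE.
  by case: (ord3 i) => ->.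
have rr : bform M r0 r0 != 0.
  apply/eqP => rr; have : (mk r0)^T *m M *m mk r0 \in unitmx.
    by rewrite !unitmx_mul unitmx_tr uP uM.
  rewrite (mkE r0 pr qr) unitmxE unitfE det_mx33 !mxE /= rr.
  by rewrite !(mul0r, mulr0, subr0, addr0) eqxx.
pose r := (sqrtC (bform M r0 r0))^-1 *: r0.
have er : (mk r)^T *m M *m mk r = conic_mx.
  rewrite mkE /r ?bformZr ?pr ?qr ?mulr0 // bform_sym // bformZr mulrA -expr2.
  by rewrite exprVn sqrtCK mulVf.
exists (mk r) => //.
have : conic_mx \in unitmx.
  rewrite unitmxE unitfE (_ : \det _ = - 4); last by rewrite det_mx33 !mxE /=; ring.
  by rewrite oppr_eq0 pnatr_eq0.
by rewrite -er !unitmx_mul unitmx_tr => /andP[_].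
Qed.

(** The conic is the discriminant of binary quadratic forms, an invariant of weight 2. *)
Lemma iota_conic (A : 'M[K]_2) :
  (iota_mx A)^T *m conic_mx *m iota_mx A = (\det A) ^+ 2 *: conic_mx.
Proof.
apply/matrixP => i j; rewrite det_mx2 !mxE !(big_ord_recl, big_ord0) !mxE /=.
rewrite !(big_ord_recl, big_ord0) !mxE /=.
by case: i => -[|[|[|//]]] ? /=; case: j => -[|[|[|//]]] ? /=; ring.
Qed.

Lemma conic_point v : bform conic_mx v v = 0 ->
  exists s t, v = vec3 (s ^+ 2) (2 * s * t) (t ^+ 2).
Proof.
rewrite [v]vec3P /bform !mxE !(big_ord_recl, big_ord0) !mxE /=.
rewrite !(big_ord_recl, big_ord0) !mxE /=; set x := v 0 0; set y := v 1 0; set z := v 2%:R 0.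
move=> e; have {}e : y ^+ 2 = 4 * x * z.
  by apply/eqP; rewrite -subr_eq0 -e; apply/eqP; ring.
have [x0|x0] := eqVneq x 0.
  move/eqP: e; rewrite x0 mulr0 mul0r expf_eq0 /= => /eqP ->.
  by exists 0, (sqrtC z); rewrite sqrtCK expr0n mulr0 mul0r.
have s0 : sqrtC x != 0 by rewrite sqrtC_eq0.
exists (sqrtC x), (y / (2 * sqrtC x)); congr vec3; first by rewrite sqrtCK.
  by field.
by rewrite expr_div_n exprMn sqrtCK e; field.
Qed.

(* B sends [1:0:0] and [0:0:1] to points of the conic; the 2x2 matrix whose
   columns parametrize them has the same image as B up to the sign of the
   middle column. *)
Lemma conic_stabilizer B c : c != 0 -> B^T *m conic_mx *m B = c *: conic_mx ->
  exists2 A : 'M[K]_2, \det A = 1 & exists2 k, k != 0 & B = k *: iota_mx A.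
Proof.
move=> c0 eB.
have bB i j : bform conic_mx (col i B) (col j B) = c * conic_mx i j.
  by rewrite -bform_mx eB mxE.
have [s [t e0]] : exists s t, col 0 B = vec3 (s ^+ 2) (2 * s * t) (t ^+ 2).
  by apply: conic_point; rewrite bB !mxE mulr0.
have [s' [t' e2]] : exists s t, col 2%:R B = vec3 (s ^+ 2) (2 * s * t) (t ^+ 2).
  by apply: conic_point; rewrite bB !mxE mulr0.
pose A0 : 'M[K]_2 := \matrix_(i, j) (nth [::] [:: [:: s; s']; [:: t; t']] i)`_j.
have i0 : col 0 (iota_mx A0) = col 0 B.
  by rewrite e0; apply/colP => -[[|[|[|//]]]] ?; rewrite !mxE.
have i2 : col 2%:R (iota_mx A0) = col 2%:R B.
  by rewrite e2; apply/colP => -[[|[|[|//]]]] ?; rewrite !mxE.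
have n2 : (-2 : K) != 0 by rewrite oppr_eq0 pnatr_eq0.
have detA : \det A0 ^+ 2 = c.
  have := bB 0 2%:R; rewrite -i0 -i2 -bform_mx iota_conic !mxE /=.
  by move/(mulIf n2).
have uI : iota_mx A0 \in unitmx.
  by rewrite unitmxE det_iota_mx unitrX // unitfE -sqrf_eq0 detA.
pose N := invmx (iota_mx A0) *m B.
have eBN : B = iota_mx A0 *m N by rewrite mulKVmx.
have N0 : col 0 N = delta_mx 0 0.
  by rewrite colE -mulmxA -colE -i0 colE mulKmx.
have N2 : col 2%:R N = delta_mx 2%:R 0.
  by rewrite colE -mulmxA -colE -i2 colE mulKmx.
clearbody N.
have eN : N^T *m conic_mx *m N = conic_mx.
  apply: (scalerI c0); rewrite -eB.
  transitivity (N^T *m ((iota_mx A0)^T *m conic_mx *m iota_mx A0) *m N).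
    by rewrite iota_conic detA -scalemxAr -scalemxAl.
  by rewrite [in RHS]eBN trmx_mul !mulmxA.
have bN i j : bform conic_mx (col i N) (col j N) = conic_mx i j.
  by rewrite -bform_mx eN.
have bE u v : bform conic_mx u v = u 1 0 * v 1 0 - 2 * (u 0 0 * v 2%:R 0 + u 2%:R 0 * v 0 0).
  rewrite [u]vec3P [v]vec3P /bform !mxE !(big_ord_recl, big_ord0) !mxE /=.
  by rewrite !(big_ord_recl, big_ord0) !mxE /=; ring.
have x0 : N 0 1 = 0.
  have := bN 1 2%:R; rewrite N2 bE !mxE /= => e; apply: (mulfI n2).
  by rewrite mulr0 -e; ring.
have z0 : N 2%:R 1 = 0.
  have := bN 1 0; rewrite N0 bE !mxE /= => e; apply: (mulfI n2).
  by rewrite mulr0 -e; ring.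
have y1 : N 1 1 ^+ 2 = 1.
  by have := bN 1 1; rewrite bE !mxE /= x0 z0 !mul0r addr0 mulr0 subr0 expr2.
(* [N] is diag(1, e, 1) with e^2 = 1, which is the image under [iota_mx] of diag(1, e). *)
pose D : 'M[K]_2 := \matrix_(i, j) (nth [::] [:: [:: 1; 0]; [:: 0; N 1 1]] i)`_j.
have ND : N = iota_mx D.
  have ord3 (i : 'I_3) : [\/ i = 0, i = 1 | i = 2%:R].
    case: i => -[|[|[|//]]] lt3; [apply: Or31|apply: Or32|apply: Or33]; exact: val_inj.
  have Nj j (v : 'cV[K]_3) i : col j N = v -> N i j = v i 0 by move=> <-; rewrite mxE.
  apply/matrixP => i j; case: (ord3 j) => ->.
  - by rewrite (Nj _ _ _ N0) !mxE; case: (ord3 i) => -> /=; rewrite ?mulr0 ?mul0r ?expr1n ?expr0n.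
  - case: (ord3 i) => ->; rewrite ?x0 ?z0 !mxE /=; by [ring|rewrite mulr0|rewrite mul0r].
  - rewrite (Nj _ _ _ N2) !mxE; case: (ord3 i) => -> /=;
    by rewrite ?y1 ?mulr0 ?mul0r ?expr1n ?expr0n.
have eBA : B = iota_mx (A0 *m D) by rewrite iota_mxM -ND.
have d0 : \det (A0 *m D) != 0.
  rewrite det_mulmx mulf_neq0 //; first by rewrite -sqrf_eq0 detA.
  rewrite det_mx2 !mxE /= mul0r subr0 mul1r -sqrf_eq0 y1.
  exact: oner_neq0.
pose r := sqrtC (\det (A0 *m D)); have r0 : r != 0 by rewrite sqrtC_eq0.
exists (r^-1 *: (A0 *m D)).
  by rewrite detZ exprVn sqrtCK mulVf.
exists (r ^+ 2); first by rewrite expf_neq0.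
by rewrite -iota_mxZ scalerA mulfV // scale1r.
Qed.

End Conics.
(** * Groups of projective transformations *)

Section MatrixContinuity.
Context (K : numClosedFieldType).

Lemma continuous_mxP (T : topologicalType) m n (f : T -> 'M[K]_(m, n)) :
  (forall i j, continuous (fun x => f x i j)) -> continuous f.
Proof.
move=> fc x A [P fP sPA]; apply: filterS (_ : nbhs x [set y | forall i j, P i j (f y i j)]).
  by move=> y Py; apply: sPA.
by apply: filter_forall => i; apply: filter_forall => j; apply: fc; apply: fP.
Qed.

Lemma continuous_entry (T : topologicalType) m n (f : T -> 'M[K]_(m, n)) i j :
  continuous f -> continuous (fun x => f x i j).
Proof.
move=> fc x; apply: (continuous_comp (g := fun M : 'M[K]_(m, n) => M i j)) (fc x) _.
exact: coord_continuous.
Qed.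

Lemma continuous_mulmx (T : topologicalType) m n p (f : T -> 'M[K]_(m, n))
    (g : T -> 'M[K]_(n, p)) :
  continuous f -> continuous g -> continuous (fun x => f x *m g x).
Proof.
move=> fc gc; apply: continuous_mxP => i j.
under eq_fun do rewrite mxE.
elim: (index_enum _) => [|k r IH].
  rewrite [X in continuous X](_ : _ = fun=> 0); first by move=> x; apply: cvg_cst.
  by apply/funext => x; rewrite big_nil.
rewrite [X in continuous X](_ : _ = fun x => f x i k * g x k j +
  \sum_(k <- r) f x i k * g x k j); last by apply/funext => x; rewrite big_cons.
move=> x; apply: cvgD (IH x).
by apply: cvgM; [apply: continuous_entry fc _ | apply: continuous_entry gc _].
Qed.

Lemma continuous_iota_mx (T : topologicalType) (f : T -> 'M[K]_2) :
  continuous f -> continuous (fun x => iota_mx (f x)).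
Proof.
move=> fc; have ec i j : continuous (fun x => f x i j) by apply: continuous_entry.
have M2 i j k l : continuous (fun x => f x i j * f x k l).
  by move=> x; apply: cvgM (ec _ _ x) (ec _ _ x).
have M3 i j k l : continuous (fun x => 2 * f x i j * f x k l).
  by move=> x; apply: cvgM (ec _ _ x); apply: cvgM (ec _ _ x); apply: cvg_cst.
have D4 i j k l i' j' k' l' :
    continuous (fun x => f x i j * f x k l + f x i' j' * f x k' l').
  by move=> x; apply: cvgD (M2 _ _ _ _ x) (M2 _ _ _ _ x).
apply: continuous_mxP => i j; under eq_fun do rewrite mxE !expr2.
case: i => -[|[|[|//]]] ? /=; case: j => -[|[|[|//]]] ? /=.
- exact: M2.
- exact: M2.
- exact: M2.
- exact: M3.
- exact: D4.
- exact: M3.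
- exact: M2.
- exact: M2.
- exact: M2.
Qed.

End MatrixContinuity.

Section ProjectiveGroups.
Context (K : numClosedFieldType).
Local Open Scope group_scope.

Section Subgroup.
Context (T : groupType) (G : set T) (sG : subgroup G).

Lemma subgroup1 : G 1.
Proof. by case: sG => /set_mem. Qed.

Lemma subgroupV x : G x -> G x^-1.
Proof. by move=> Gx; apply/set_mem/(group_closedV sG)/mem_set. Qed.

Lemma subgroupM x y : G x -> G y -> G (x * y).
Proof. by move=> Gx Gy; apply/set_mem/(group_closedM sG); apply/mem_set. Qed.

End Subgroup.

Lemma subgroup_of (T : groupType) (G : set T) : G 1 ->
  (forall x y, G x -> G y -> G (x * y^-1)) -> subgroup G.
Proof.
move=> G1 GM; split; first exact: mem_set.
by move=> x y /set_mem Gx /set_mem Gy; apply/mem_set/GM.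
Qed.

Definition proj_SL n (A : SL K n) : PSL K n := \pi_(PSL K n) A.
Definition point n (v : nzvec K n) : Proj K n := \pi_(Proj K n) v.

Lemma proj_SLP n (g : PSL K n) : exists A, g = proj_SL A.
Proof. by exists (repr g); rewrite /proj_SL reprK. Qed.

Lemma pointP n (p : Proj K n) : exists v, p = point v.
Proof. by exists (repr p); rewrite /point reprK. Qed.

Lemma proj_SLM n (A B : SL K n) : proj_SL A * proj_SL B = proj_SL (A * B).
Proof. exact: pi_PSL_mul. Qed.

Lemma proj_SLV n (A : SL K n) : (proj_SL A)^-1 = proj_SL A^-1.
Proof. exact: pi_PSL_inv. Qed.

Lemma proj_SL_act n (A : SL K n) v : PSL_act (proj_SL A) (point v) = point (SL_act A v).
Proof. exact: pi_PSL_act. Qed.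

Lemma proj_SL_iota (A : SL K 2) : PSL_iota (proj_SL A) = proj_SL (SL_iota A).
Proof. exact: pi_PSL_iota. Qed.

Lemma PSL_act1 n (p : Proj K n) : PSL_act 1 p = p.
Proof.
have [v ->] := pointP p; rewrite [1](_ : _ = proj_SL 1) // proj_SL_act.
by congr point; apply: val_inj; apply: mul1mx.
Qed.

Lemma PSL_actM n (g h : PSL K n) p : PSL_act (g * h) p = PSL_act g (PSL_act h p).
Proof.
have [A ->] := proj_SLP g; have [B ->] := proj_SLP h; have [v ->] := pointP p.
rewrite proj_SLM !proj_SL_act; congr point; apply: val_inj.
by rewrite /= mulmxA.
Qed.

Lemma image_PSL_actM n (g h : PSL K n) L :
  PSL_act (g * h) @` L = PSL_act g @` (PSL_act h @` L).
Proof. by rewrite image_comp; apply: eq_imagel => p _; rewrite PSL_actM. Qed.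

Lemma image_PSL_act1 n (L : set (Proj K n)) : PSL_act 1 @` L = L.
Proof.
by apply/seteqP; split => [_ [p Lp <-]|p Lp]; [|exists p => //]; rewrite PSL_act1.
Qed.

(** For the stabilizer [H] of [L], the coset [g H] consists of the elements of [G] taking [L] to
    [g L], so it is determined by a point of the finite orbit. *)
Lemma finite_line_orbit_virtually_affine (G : set (PSL K 3)) L : subgroup G ->
  projective_line L -> finite_set [set PSL_act g @` L | g in G] -> virtually_affine G.
Proof.
move=> sG lineL finL; pose H := [set g | G g /\ PSL_act g @` L = L].
have HV g : PSL_act g @` L = L -> PSL_act g^-1 @` L = L.
  by move=> gL; rewrite -{1}gL -image_PSL_actM mulVg image_PSL_act1.
exists H; split; last by exists L => // g [].
- apply: subgroup_of; first by split; [exact: subgroup1|exact: image_PSL_act1].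
  move=> x y [Gx xL] [Gy yL]; split.
    by apply: subgroupM => //; apply: subgroupV.
  by rewrite image_PSL_actM HV.
- by move=> g [].
apply: sub_finite_set (finite_image (fun L' => [set k | G k /\ PSL_act k @` L = L']) finL).
move=> _ [g Gg <-] /=; exists (PSL_act g @` L); first by exists g.
apply/seteqP; split => [k [Gk kL]|_ [h [Gh hL] <-]]; last first.
  by split; [exact: subgroupM | rewrite image_PSL_actM hL].
exists (g^-1 * k); last by rewrite mulgA mulgV mul1g.
split; first by apply: subgroupM => //; apply: subgroupV.
by rewrite image_PSL_actM kL -image_PSL_actM mulVg image_PSL_act1.
Qed.

Lemma zero_locusE (F : {mpoly K[3]}) d (v : nzvec K 3) : F \is d.-homog ->
  zero_locus F (point v) <-> mev F v = 0%R.
Proof.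
move=> hF; split=> [/(_ v erefl)//|Fv w /Proj_eqP/proportionalP[c c0 e]].
move: Fv; rewrite e (mev_homogZ _ _ hF) => /eqP.
by rewrite mulf_eq0 expf_eq0 (negPf c0) andbF => /eqP.
Qed.

Lemma image_zero_locus (F : {mpoly K[3]}) d (A : SL K 3) : F \is d.-homog ->
  PSL_act (proj_SL A) @` zero_locus F = zero_locus (mcomp (invmx A) F).
Proof.
move=> hF; have hF' := mcomp_homog (invmx A) hF.
apply/seteqP; split => [_ [p Fp <-]|p].
  have [v ev] := pointP p; move: Fp; rewrite ev => /(zero_locusE _ hF) Fv.
  rewrite proj_SL_act; apply/(zero_locusE _ hF').
  by rewrite mev_comp mulKmx ?SL_unitmx.
have [v ->] := pointP p => /(zero_locusE _ hF') Fv.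
exists (point (SL_act A^-1 v)).
  by apply/(zero_locusE _ hF); move: Fv; rewrite mev_comp.
by rewrite -proj_SL_act -PSL_actM -proj_SLV mulgV PSL_act1.
Qed.

Lemma linform_projective_line (a : 'rV[K]_3) : a != 0%R ->
  projective_line (zero_locus (linform a)).
Proof.
move=> a0; exists a => //; apply/seteqP; split => p H v /H.
  rewrite -/(mev _ _) mev_linform => e; apply/matrixP => i j.
  by rewrite !ord1 e mxE.
by rewrite -/(mev _ _) mev_linform => ->; rewrite mxE.
Qed.

Lemma homog1_linform (F : {mpoly K[3]}) : F \is 1.-homog -> exists a, F = linform a.
Proof.
move=> hF; exists (\row_i mev F^`M(i) 0)%R; rewrite -[LHS]mulr1n -(euler_homog hF).
apply: eq_bigr => i _; rewrite mxE.
by rewrite {1}(dhomog0_const (mderiv_homog i hF)) mev_at0 mulrC mul_mpolyC.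
Qed.

(** All lifts of elements of [G] are kept, so that products and inverses stay in the group exactly
    and not just up to scalars. *)
Definition lift_group (G : set (PSL K 3)) (A : 'M[K]_3) : Prop :=
  exists2 a : SL K 3, G (proj_SL a) & A = a.

Lemma lift_group_matrix_group G : subgroup G -> matrix_group (lift_group G).
Proof.
move=> sG; split.
- by exists 1 => //; exact: (subgroup1 sG).
- move=> _ _ [a Ga ->] [b Gb ->]; exists (a * b) => //.
  by rewrite -proj_SLM; apply: subgroupM.
- move=> _ [a Ga ->]; exists a^-1 => //.
  by rewrite -proj_SLV; apply: subgroupV.
- by move=> _ [a _ ->]; apply: SL_unitmx.
Qed.

Lemma PSL_iotaM (g h : PSL K 2) : PSL_iota (g * h) = PSL_iota g * PSL_iota h.
Proof.
have [A ->] := proj_SLP g; have [B ->] := proj_SLP h.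
rewrite proj_SLM !proj_SL_iota proj_SLM.
by congr proj_SL; apply: val_inj; rewrite /= iota_mxM.
Qed.

Lemma PSL_iota1 : PSL_iota (1 : PSL K 2) = 1.
Proof. by apply: (@mulgI _ (PSL_iota 1)); rewrite -PSL_iotaM !mulg1. Qed.

Lemma PSL_iotaV (g : PSL K 2) : PSL_iota g^-1 = (PSL_iota g)^-1.
Proof. by apply: (@mulgI _ (PSL_iota g)); rewrite -PSL_iotaM !mulgV PSL_iota1. Qed.

(** If the image of [A] is scalar, its corners b^2 and c^2 vanish, and then ad = a^2 with a nonzero
    gives d = a. *)
Lemma PSL_iota_inj : injective (@PSL_iota K).
Proof.
suff ker1 (g : PSL K 2) : PSL_iota g = 1 -> g = 1.
  move=> g h gh; apply: (@mulIg _ h^-1); rewrite mulgV; apply: ker1.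
  by rewrite PSL_iotaM PSL_iotaV gh mulgV.
have [A ->] := proj_SLP g; rewrite proj_SL_iota => /PSL_eqP/proportionalP[c c0 /= e].
have eE i j := congr1 (fun M : 'M[K]_3 => M i j) e.
have b0 : A 0%R 1%R = 0%R.
  have := eE 0%R 2%:R%R; rewrite !mxE /= mulr0 => /eqP.
  by rewrite expf_eq0 => /eqP.
have c'0 : A 1%R 0%R = 0%R.
  have := eE 2%:R%R 0%R; rewrite !mxE /= mulr0 => /eqP.
  by rewrite expf_eq0 => /eqP.
have := eE 1%R 1%R; rewrite !mxE /= b0 mul0r addr0 mulr1 => ad.
have := eE 0%R 0%R; rewrite !mxE /= mulr1 => aa.
have a0 : (A 0 0 != 0)%R by rewrite -sqrf_eq0 aa.
have da : A 1%R 1%R = A 0%R 0%R by apply: (mulfI a0); rewrite ad -expr2.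
apply/PSL_eqP/proportionalP; exists (A 0%R 0%R) => //=.
apply/matrixP => i j; rewrite !mxE.
have ord2 (k : 'I_2) : k = 0%R \/ k = 1%R.
  by case: k => -[|[|//]] lt2; [left|right]; apply: val_inj.
by case: (ord2 i) => ->; case: (ord2 j) => ->; rewrite ?b0 ?c'0 ?da ?mulr1 ?mulr0.
Qed.

(** By the quotient topology it suffices to work on SL(2), and by the initial topology on SL(3) to
    look at matrices, whose entries are polynomial. *)
Lemma continuous_conj_iota (g : PSL K 3) : continuous (fun x => g^-1 * PSL_iota x * g).
Proof.
have [b ->] := proj_SLP g; apply/quotient_continuous.
have -> : (fun x => (proj_SL b)^-1 * PSL_iota x * proj_SL b) \o \pi_(PSL K 2) =
    @proj_SL 3 \o (fun A => b^-1 * SL_iota A * b).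
  apply/funext => A.
  transitivity ((proj_SL b)^-1 * PSL_iota (proj_SL A) * proj_SL b) => //.
  by rewrite proj_SL_iota proj_SLV (proj_SLM b^-1) (proj_SLM (b^-1 * _)).
move=> A; apply: continuous_comp; last exact: pi_continuous.
move: A; apply/continuousP => U [V oV <-].
have fc : continuous (fun A : SL K 2 => invmx b *m iota_mx A *m b)%R.
  apply: continuous_mulmx; last exact: cst_continuous.
  apply: continuous_mulmx; first exact: cst_continuous.
  by apply: continuous_iota_mx; apply: initial_continuous.
by move/continuousP: fc => /(_ V oV).
Qed.

Lemma discrete_set_preimage (S T : topologicalType) (f : S -> T) (A : set T) :
  continuous f -> injective f -> discrete_set A -> discrete_set (f @^-1` A).
Proof.
move=> fc fi dA x Ax; have [_ [V Vx VA]] := dA _ Ax.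
split; first exact: mem_set.
exists (f @^-1` V); first exact: fc.
apply/seteqP; split => y /=.
  by move=> Vy; apply: fi; have : [set f x] (f y) by rewrite -VA.
by move=> ->; split => //; apply: nbhs_singleton.
Qed.

End ProjectiveGroups.

(** * The invariant line and the invariant conic *)

Section Conclusion.
Context (K : numClosedFieldType) (G : set (PSL K 3)) (sG : subgroup G).
Local Open Scope group_scope.

Lemma minimal_linear_virtually_affine f : minimal_form (lift_group G) 1 f ->
  virtually_affine G.
Proof.
move=> [_ hf f0 [s sP] _]; have [a ef] := homog1_linform hf.
have a0 : a != 0%R by rewrite -linform_eq0 -ef.
apply: (finite_line_orbit_virtually_affine sG (linform_projective_line a0)).
apply: sub_finite_set (finite_image (@zero_locus K) (finite_seq s)).
move=> _ [g Gg <-]; have [A eg] := proj_SLP g.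
rewrite -ef eg (image_zero_locus _ hf).
have [|c c0 [F Fs ->]] := sP (mcomp (invmx A) f).
  by exists (invmx A) => //; exists A^-1 => //; rewrite -proj_SLV -eg; apply: subgroupV.
exists F => //; apply/seteqP; split => p H v /H; rewrite mevalZ => /eqP.
  by move=> /eqP ->; rewrite mulr0.
by rewrite mulf_eq0 (negPf c0) => /eqP.
Qed.

Lemma SL_scale n (P : 'M[K]_n.+1) : P \in unitmx ->
  exists (b : SL K n.+1), exists2 k : K, k != 0%R & SLmx b = (k *: P)%R.
Proof.
rewrite unitmxE unitfE => dP; pose r := n.+1.-root (\det P).
have r0 : (r != 0)%R by rewrite rootC_eq0.
have db : (\det (r^-1 *: P) == 1)%R by rewrite detZ exprVn rootCK // mulVf.
by exists (MkSL db), (r^-1)%R => //; rewrite invr_eq0.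
Qed.

(** [P] carries the Veronese conic to that of [M]. [Gamma] is the full preimage of [G] under the
    embedding [iota] followed by conjugation by [g], so discreteness pulls back along a continuous
    injection; [conic_stabilizer] shows that all of [G] is reached. *)
Lemma conic_group (M : 'M[K]_3) : discrete_set G -> M^T = M -> M \in unitmx ->
  (forall A, lift_group G A -> exists2 c, c != 0 & A^T *m M *m A = c *: M)%R ->
  exists (Gamma : set (PSL K 2)) (g : PSL K 3),
    kleinian Gamma /\ conj_set g G = PSL_iota @` Gamma.
Proof.
move=> dG Ms uM GM; have [P uP eP] := conic_normal_form Ms uM.
have [b [k k0 eb]] := SL_scale uP.
pose g := proj_SL b; pose Gamma := [set x : PSL K 2 | G (g * PSL_iota x * g^-1)].
exists Gamma, g^-1; split; first split.
- apply: subgroup_of => [|x y Gx Gy]; rewrite /Gamma /=.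
    by rewrite PSL_iota1 mulg1 mulgV; exact: (subgroup1 sG).
  have := subgroupM sG Gx (subgroupV sG Gy).
  by rewrite !invgM invgK PSL_iotaM PSL_iotaV !mulgA mulgVK.
- have -> : Gamma = (fun x => (g^-1)^-1 * PSL_iota x * g^-1) @^-1` G.
    by apply/seteqP; split => x; rewrite /Gamma /= invgK.
  apply: discrete_set_preimage dG; first exact: continuous_conj_iota.
  by move=> x y /mulIg /mulgI /PSL_iota_inj.
apply/seteqP; split => [_ [x Gx <-]|_ [x Gx <-]]; last first.
  by exists (g * PSL_iota x * g^-1) => //; rewrite invgK !mulgA mulVg mul1g mulgVK.
have [a ex] := proj_SLP x; pose B := (b^-1 * a * b : SL K 3).
have [|c c0 ea] := GM a; first by exists a => //; rewrite -ex.
have eJ : (B^T *m conic_mx K *m B = c *: conic_mx K)%R.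
  have -> : SLmx B = (invmx P *m a *m P)%R.
    transitivity (invmx b *m a *m b)%R => //; rewrite eb invmxZ ?unitmxZ ?unitfE //.
    by rewrite -!scalemxAl -scalemxAr scalerA mulVf // scale1r.
  rewrite -eP; transitivity (P^T *m (a^T *m M *m a) *m P)%R; last first.
    by rewrite ea -scalemxAr -scalemxAl.
  by rewrite !trmx_mul trmx_inv !mulmxA mulmxKV ?unitmx_tr // mulmxK.
have [A dA [d d0 eB]] := conic_stabilizer c0 eJ.
have dA' : (\det A == 1)%R by rewrite dA.
have eBA : g^-1 * x * g = PSL_iota (proj_SL (MkSL dA')).
  rewrite ex /g proj_SLV (proj_SLM b^-1 a) (proj_SLM (b^-1 * a) b) proj_SL_iota.
  by apply/PSL_eqP/proportionalP; exists d.
exists (proj_SL (MkSL dA')); last by rewrite -eBA invgK.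
by rewrite /Gamma /= -eBA !mulgA mulgV mul1g mulgK.
Qed.

(** Invariance concerns zero loci only: a translate of [F] has the same zeros but perhaps other
    multiplicities. Forms of degree [d] with these zeros are still finite in number up to
    scalars. *)
Lemma exceptional_finite_orbit (S : set (Proj K 3)) : exceptional_algebraic_set G S ->
  exists d f, [/\ (0 < d)%N, f \is d.-homog, f != 0%R & finite_orbit (lift_group G) f].
Proof.
move=> [[d [F [d0 hF F0 eS]]] inv]; exists d, F; split=> //.
have [_ _ _ GU] := lift_group_matrix_group sG.
apply: (finite_orbit_invariant GU _ d0 hF F0 hF F0) => // _ v [a Ga ->] v0 Fav.
have := inv _ (subgroupV sG Ga); rewrite eS proj_SLV (image_zero_locus _ hF) => eZ.
pose w := NzVec v0; have : zero_locus F (point w).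
  rewrite -eZ; apply/(zero_locusE _ (mcomp_homog _ hF)).
  by rewrite mev_comp invmxK.
by move/(zero_locusE _ hF).
Qed.

End Conclusion.

Theorem corollary0p4 (R : realType) (G : set (PSL R[i] 3)) :
  subgroup G -> infinite_set G -> discrete_set G ->
  (exists S : set (Proj R[i] 3), exceptional_algebraic_set G S) ->
  virtually_affine G \/
  exists (Gamma : set (PSL R[i] 2)) (g : PSL R[i] 3),
    kleinian Gamma /\ conj_set g G = PSL_iota @` Gamma.
Proof.
move=> sG _ dG [S /(exceptional_finite_orbit sG)[d [F [d0 hF F0 GF]]]].
have GmG := lift_group_matrix_group sG.
have [m [f minf]] := minimal_form_exists d0 hF F0 GF.
have := minimal_degree_le2 GmG minf; have [m0 _ _ _ _] := minf.
case: m minf m0 => [|[|[|//]]] minf // _ _.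
  by left; apply: minimal_linear_virtually_affine minf.
right; apply: (conic_group sG dG (hmx_sym f 0)).
  exact: (minimal_quadratic_unitmx GmG minf).
move=> A GA; have [c c0 e] := minimal_quadratic_fixed GmG minf GA.
by exists c => //; rewrite -hmxZ -e hmx_comp mulmx0.
Qed.
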